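(* Let $G$ be a finite $3$-dimensional crystallographic point group. Then every torsion unit of $V(\mathbb{Z}G)$ is conjugate within $\mathbb{Q}G$ to an element of $G$.
   Context: A finite $3$-dimensional crystallographic point group is a finite group of orthogonal transformations of $\mathbb{R}^3$ that maps some lattice of rank $3$ in $\mathbb{R}^3$ onto itself (equivalently, up to isomorphism, a finite subgroup of $GL_3(\mathbb{Z})$). For a finite group $G$, $V(\mathbb{Z}G)$ denotes the group of units of augmentation $1$ of the integral group ring $\mathbb{Z}G$, where the augmentation of $\sum_g \alpha_g g$ is $\sum_g \alpha_g$. A torsion unit is a unit of finite order; ''conjugate within $\mathbb{Q}G$'' means conjugate by a unit of the rational group algebra $\mathbb{Q}G$. *)

(* Defs.v *)
From HB Require Import structures.
From mathcomp Require Import all_boot all_order all_algebra all_fingroup.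
Set Implicit Arguments. Unset Strict Implicit. Unset Printing Implicit Defensive.
Import Order.TTheory GRing.Theory Num.Theory.
Local Open Scope ring_scope.

(* The group ring R[G] of a finite group gT (the whole type), with
   coefficients in a ring R: elements are finite functions gT -> R,
   a = \sum_g a(g) g, multiplied by convolution. *)
Section GroupRing.
Variables (gT : finGroupType) (R : nzRingType).

Definition grelt := {ffun gT -> R}.

Definition gr_mul (a b : grelt) : grelt :=
  [ffun x => \sum_(y : gT) a y * b ((y^-1 * x)%g)].

Definition gr_of (g : gT) : grelt := [ffun x => (x == g)%:R].

Definition gr_one : grelt := gr_of 1%g.

Definition gr_pow (a : grelt) (n : nat) : grelt := iter n (gr_mul a) gr_one.

Definition gr_unit (a : grelt) : Prop :=
  exists b, gr_mul a b = gr_one /\ gr_mul b a = gr_one.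

Definition augmentation (a : grelt) : R := \sum_(x : gT) a x.

Definition gr_torsion (a : grelt) : Prop := exists n : nat, (0 < n)%N /\ gr_pow a n = gr_one.
End GroupRing.

Definition gr_ZtoQ (gT : finGroupType) (a : {ffun gT -> int}) : {ffun gT -> rat} :=
  [ffun x => (a x)%:~R].

Definition torsion_unit_V (gT : finGroupType) (u : {ffun gT -> int}) : Prop :=
  gr_unit u /\ augmentation u = 1 /\ gr_torsion u.

Definition QG_conjugate (gT : finGroupType) (a b : {ffun gT -> rat}) : Prop :=
  exists w w' : {ffun gT -> rat},
    [/\ gr_mul w w' = gr_one gT rat, gr_mul w' w = gr_one gT rat
      & gr_mul w' (gr_mul a w) = b].

(* G is (isomorphic to) a finite subgroup of GL_3(Z): there is an injective
   monoid homomorphism G -> M_3(Z) (its image then consists of units). *)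
Definition crystallographic3 (gT : finGroupType) : Prop :=
  exists rho : gT -> 'M[int]_3,
    [/\ injective rho, rho 1%g = 1%:M
      & forall x y : gT, rho (x * y)%g = rho x *m rho y].

(* Main.v *)
Require Import Defs.
From mathcomp Require Import all_boot all_order all_algebra all_fingroup.
From mathcomp Require Import cyclic center commutator pgroup sylow nilpotent abelian frobenius.
From mathcomp Require Import all_field all_character.
From mathcomp Require Import zify ring.
Set Implicit Arguments. Unset Strict Implicit. Unset Printing Implicit Defensive.
Import Order.TTheory GRing.Theory Num.Theory GroupScope.
Local Open Scope ring_scope.

(** Let [u] be a torsion unit of augmentation 1 of ZG and call [u] class-like if its
    partial augmentations (sums of coefficients over conjugacy classes) are those of
    some group element.

    If every torsion unit of V(ZG) is class-like, then the congruence
    [(sum a_x x)^p = sum a_x x^p] modulo [p] and commutators shows that the powers of [u]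
    have the partial augmentations of the powers of a single [g].  The trace of
    [z |-> u^k z h] on CG is [#|C(h)|] times a partial augmentation of [u^k], so [u] and
    [g] make CG into isomorphic modules over [Z/n x G]; an isomorphism is left
    multiplication by a unit [w] with [w u = g w], and a generic rational
    [sum_k g^k a u^-k] is then such a unit over Q.

    By Berman-Higman, [u] is class-like as soon as noncentral elements in the same coset
    of the derived subgroup are conjugate.  A finite subgroup of [SL_3(Z)] has order
    dividing 24 by integrality of inner products of characters; this criterion covers
    all orders but 24, where the group is the octahedral group.  There the quotient by
    the Klein subgroup, the two faithful characters of degree 3 and the congruence for
    [p = 2] leave one spurious possibility, in which [u] acts as [1] and [-1] in the two
    representations; the integrality of the coefficients of [u] excludes it.  Finally
    [g |-> det(g) g] reduces [GL_3(Z)] to [SL_3(Z)] up to a central factor [C_2], for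
    which the two projections of [u] are congruent modulo 2. *)

(** * Group rings *)

Section GroupRingTheory.
Variables (gT : finGroupType) (R : comNzRingType).
Implicit Types (a b c : {ffun gT -> R}).

(** Values in an arbitrary module let one identity serve associativity, matrix representations,
    scalar functionals and push-forwards. *)
Lemma sum_gr_mul (V : lmodType R) (F : gT -> V) a b :
  \sum_x gr_mul a b x *: F x = \sum_y \sum_z (a y * b z) *: F (y * z)%g.
Proof.
under eq_bigr do rewrite ffunE scaler_suml.
rewrite exchange_big; apply: eq_bigr => y _.
rewrite (reindex_inj (mulgI y)); apply: eq_bigr => z _.
by rewrite mulKg.
Qed.

Lemma gr_mulA a b c : gr_mul (gr_mul a b) c = gr_mul a (gr_mul b c).
Proof.
apply/ffunP => x; rewrite ffunE.
rewrite (sum_gr_mul (V := R^o) (fun y => c (y^-1 * x)%g)) ffunE.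
apply: eq_bigr => y _; rewrite ffunE mulr_sumr; apply: eq_bigr => z _.
by rewrite /GRing.scale /= mulrA invMg mulgA.
Qed.

Lemma gr_mul_ofl g a x : gr_mul (gr_of R g) a x = a (g^-1 * x)%g.
Proof.
rewrite ffunE (bigD1 g) //= ffunE eqxx mul1r big1 ?addr0 // => y /negPf ny.
by rewrite ffunE ny mul0r.
Qed.

Lemma gr_mul_ofr g a x : gr_mul a (gr_of R g) x = a (x * g^-1)%g.
Proof.
rewrite ffunE (bigD1 (x * g^-1)%g) //= ffunE invMg invgK mulgKV eqxx mulr1.
rewrite big1 ?addr0 // => y ny; rewrite ffunE; case: eqP => [e|]; last by rewrite mulr0.
by case/eqP: ny; rewrite -e invMg invgK mulVKg.
Qed.

Lemma gr_mul1l a : gr_mul (gr_one gT R) a = a.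
Proof. by apply/ffunP => x; rewrite gr_mul_ofl invg1 mul1g. Qed.

Lemma gr_mul1r a : gr_mul a (gr_one gT R) = a.
Proof. by apply/ffunP => x; rewrite gr_mul_ofr invg1 mulg1. Qed.

Lemma gr_powS a n : gr_pow a n.+1 = gr_mul a (gr_pow a n).
Proof. by []. Qed.

Lemma gr_pow1 a : gr_pow a 1 = a.
Proof. exact: gr_mul1r. Qed.

Lemma gr_powD a m n : gr_pow a (m + n) = gr_mul (gr_pow a m) (gr_pow a n).
Proof.
by elim: m => [|m IH]; rewrite ?gr_mul1l // addSn !gr_powS IH gr_mulA.
Qed.

Lemma gr_powSr a n : gr_pow a n.+1 = gr_mul (gr_pow a n) a.
Proof. by rewrite -addn1 gr_powD gr_pow1. Qed.

Lemma gr_powM a m n : gr_pow a (m * n) = gr_pow (gr_pow a m) n.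
Proof. by elim: n => [|n IH]; rewrite ?muln0 // mulnS gr_powD IH. Qed.

Lemma gr_pow_one n : gr_pow (gr_one gT R) n = gr_one gT R.
Proof. by elim: n => // n IH; rewrite gr_powS IH gr_mul1l. Qed.

Lemma gr_mul_of (g h : gT) : gr_mul (gr_of R g) (gr_of R h) = gr_of R (g * h)%g.
Proof.
apply/ffunP => x; rewrite gr_mul_ofl !ffunE; congr (_%:R).
by rewrite -(inj_eq (mulgI g)) mulKVg.
Qed.

Lemma gr_pow_of (g : gT) n : gr_pow (gr_of R g) n = gr_of R (g ^+ n)%g.
Proof. by elim: n => // n IH; rewrite gr_powS IH gr_mul_of expgS. Qed.

Lemma gr_mul_scale (k l : R) a b :
  gr_mul [ffun x => k * a x] [ffun x => l * b x] = [ffun x => k * l * gr_mul a b x].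
Proof.
apply/ffunP => x; rewrite !ffunE mulr_sumr; apply: eq_bigr => y _.
by rewrite !ffunE mulrACA.
Qed.

Lemma gr_pow_scale (k : R) a n :
  gr_pow [ffun x => k * a x] n = [ffun x => k ^+ n * gr_pow a n x].
Proof.
elim: n => [|n IH]; first by apply/ffunP=> x; rewrite !ffunE expr0 mul1r.
by rewrite !gr_powS IH gr_mul_scale -exprS.
Qed.

Lemma gr_torsion_pow a n : gr_torsion a -> gr_torsion (gr_pow a n).
Proof.
case=> m [m0 am]; exists m; split => //.
by rewrite -gr_powM mulnC gr_powM am gr_pow_one.
Qed.

Definition gr_lin n (rho : gT -> 'M[R]_n) a : 'M[R]_n := \sum_x a x *: rho x.

Lemma gr_lin_mul n (rho : gT -> 'M[R]_n) a b :
    (forall x y, rho (x * y)%g = rho x *m rho y) ->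
  gr_lin rho (gr_mul a b) = gr_lin rho a *m gr_lin rho b.
Proof.
move=> rM; rewrite /gr_lin sum_gr_mul mulmx_suml; apply: eq_bigr => y _.
rewrite mulmx_sumr; apply: eq_bigr => z _.
by rewrite -scalemxAl -scalemxAr scalerA rM.
Qed.

Lemma gr_lin_of n (rho : gT -> 'M[R]_n) g : gr_lin rho (gr_of R g) = rho g.
Proof.
rewrite /gr_lin (bigD1 g) //= ffunE eqxx scale1r big1 ?addr0 // => x /negPf nx.
by rewrite ffunE nx scale0r.
Qed.

Lemma gr_lin_pow n (rho : gT -> 'M[R]_n) a m :
    rho 1%g = 1%:M -> (forall x y, rho (x * y)%g = rho x *m rho y) ->
  gr_lin rho (gr_pow a m) = gr_lin rho a ^+ m.
Proof.
move=> r1 rM; elim: m => [|m IH]; first by rewrite gr_lin_of r1.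
by rewrite gr_powS gr_lin_mul // IH exprS.
Qed.

(** For multiplicative [w] this is the ring homomorphism that extends [w]; the constant 1 gives the
    augmentation. *)
Definition waug (w : gT -> R) a : R := \sum_x a x * w x.

Lemma waug_mul w a b : (forall x y, w (x * y)%g = w x * w y) ->
  waug w (gr_mul a b) = waug w a * waug w b.
Proof.
move=> wM; rewrite /waug (sum_gr_mul (V := R^o) w) mulr_suml.
apply: eq_bigr => y _; rewrite mulr_sumr; apply: eq_bigr => z _.
by rewrite /GRing.scale /= wM mulrACA.
Qed.

Lemma waug_pow w a n : w 1%g = 1 -> (forall x y, w (x * y)%g = w x * w y) ->
  waug w (gr_pow a n) = waug w a ^+ n.
Proof.
move=> w1 wM; elim: n => [|n IH]; last by rewrite gr_powS waug_mul // IH exprS.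
rewrite /waug (bigD1 1%g) //= ffunE eqxx w1 mulr1 big1 ?addr0 // => x /negPf nx.
by rewrite ffunE nx mul0r.
Qed.

Lemma augmentation_waug a : augmentation a = waug (fun=> 1) a.
Proof. by apply: eq_bigr => x _; rewrite mulr1. Qed.

Lemma augmentation_pow a n : augmentation (gr_pow a n) = augmentation a ^+ n.
Proof. by rewrite !augmentation_waug waug_pow // => *; rewrite mulr1. Qed.

End GroupRingTheory.

(** * Push-forward along a homomorphism, twisted by a linear character *)

Section Push.
Variables (gT hT : finGroupType) (R : comNzRingType).
Variables (f : gT -> hT) (w : gT -> R).
Hypotheses (fM : forall x y, f (x * y)%g = (f x * f y)%g).
Hypotheses (w1 : w 1%g = 1) (wM : forall x y, w (x * y)%g = w x * w y).

(** Linear extension of [x |-> w x * f x]. The weight 1 gives the quotient maps, a sign character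
    the twisted projection of a double cover. *)
Definition gr_push (a : {ffun gT -> R}) : {ffun hT -> R} :=
  [ffun y => \sum_(x | f x == y) a x * w x].

Lemma gr_pushE a y : gr_push a y = \sum_x a x * (w x * (f x == y)%:R).
Proof.
rewrite ffunE big_mkcond; apply: eq_bigr => x _.
by case: eqP; rewrite ?mulr1 ?mulr0.
Qed.

Lemma sum_gr_push (P : pred hT) a :
  \sum_(y | P y) gr_push a y = \sum_(x | P (f x)) a x * w x.
Proof.
rewrite [RHS](partition_big f P) //=; apply: eq_bigr => y Py; rewrite ffunE.
by apply: eq_bigl => x; case: eqP => [->|_]; rewrite ?Py ?andbT ?andbF.
Qed.

Lemma augmentation_push a : augmentation (gr_push a) = waug w a.
Proof. by rewrite /augmentation sum_gr_push. Qed.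

Lemma gr_push_mul a b : gr_push (gr_mul a b) = gr_mul (gr_push a) (gr_push b).
Proof.
apply/ffunP => y; rewrite gr_pushE.
rewrite (sum_gr_mul (V := R^o) (fun x => w x * (f x == y)%:R)) ffunE.
transitivity (\sum_x a x * w x * gr_push b ((f x)^-1 * y)%g).
  apply: eq_bigr => x _; rewrite gr_pushE mulr_sumr; apply: eq_bigr => z _.
  rewrite /GRing.scale /= wM fM -(inj_eq (mulgI (f x)^-1)%g (f x * f z)%g) mulKg.
  by rewrite -!mulrA; congr (_ * _); rewrite mulrCA.
rewrite (partition_big f xpredT) //=; apply: eq_bigr => z _.
rewrite ffunE mulr_suml; apply: eq_bigr => x /eqP ->; by [].
Qed.

Lemma gr_push_of (g : gT) : gr_push (gr_of R g) = [ffun y => w g * gr_of R (f g) y].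
Proof.
apply/ffunP => y; rewrite gr_pushE !ffunE (bigD1 g) //= ffunE eqxx mul1r eq_sym.
by rewrite big1 ?addr0 // => x /negPf nx; rewrite ffunE nx mul0r.
Qed.

Lemma gr_push_one : gr_push (gr_one gT R) = gr_one hT R.
Proof.
have f1 : f 1%g = 1%g by apply: (mulgI (f 1%g)); rewrite -fM !mulg1.
by rewrite gr_push_of f1; apply/ffunP => y; rewrite ffunE w1 mul1r.
Qed.

Lemma gr_push_pow a n : gr_push (gr_pow a n) = gr_pow (gr_push a) n.
Proof.
elim: n => [|n IH]; first exact: gr_push_one.
by rewrite !gr_powS gr_push_mul IH.
Qed.

Lemma gr_torsion_push a : gr_torsion a -> gr_torsion (gr_push a).
Proof.
by case=> n [n0 an]; exists n; rewrite -gr_push_pow an gr_push_one.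
Qed.
End Push.

(** * Traces and the Berman-Higman theorem *)

Section Bimodule.
Variables (gT : finGroupType) (R : comNzRingType).
Implicit Types (a b : {ffun gT -> R}).

Definition part_aug a (x : gT) : R := \sum_(y in x ^: [set: gT]) a y.

(* The matrix of z |-> a z h on row vectors, so products come in reverse order in a. *)
Definition bimod_mx a (h : gT) : 'M[R]_#|gT| :=
  \matrix_(i, j) a (enum_val j * h^-1 * (enum_val i)^-1)%g.

Lemma bimod_mxM a b h k :
  bimod_mx a h *m bimod_mx b k = bimod_mx (gr_mul b a) (h * k)%g.
Proof.
apply/matrixP => i j; rewrite !mxE ffunE.
under eq_bigr do rewrite !mxE.
rewrite -(big_enum_val (A := gT) (fun y => a (y * h^-1 * (enum_val i)^-1)%g
   * b (enum_val j * k^-1 * y^-1)%g)) /=.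
rewrite (reindex_inj invg_inj) (reindex_inj (mulgI (enum_val j * k^-1)^-1)%g) /=.
apply: eq_bigr => y _; rewrite mulrC invgK mulKVg invMg invgK.
by rewrite invMg -!mulgA.
Qed.

Lemma bimod_mx1 : bimod_mx (gr_one gT R) 1%g = 1%:M.
Proof.
apply/matrixP => i j; rewrite !mxE ffunE invg1 mulg1 -(inj_eq (mulIg (enum_val i))).
by rewrite mulgKV mul1g (inj_eq enum_val_inj) eq_sym.
Qed.

Lemma bimod_mxX a n : bimod_mx a 1%g ^+ n = bimod_mx (gr_pow a n) 1%g.
Proof.
elim: n => [|n IH]; first by rewrite bimod_mx1.
by rewrite exprS IH [LHS]bimod_mxM mulg1 -gr_powSr.
Qed.

(** On the diagonal stand the coefficients of [a] at the conjugates of [h^-1], and each conjugate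
    occurs once for every element of a coset of ['C[h]]. *)
Lemma mxtrace_bimod a h :
  \tr (bimod_mx a h) = #|'C[h]|%:R * part_aug a (h^-1)%g.
Proof.
rewrite /mxtrace; under eq_bigr do rewrite !mxE.
rewrite -(big_enum_val (A := gT) (fun y => a (y * h^-1 * y^-1)%g)) /=.
rewrite (reindex_inj invg_inj) /=.
under eq_bigr do rewrite invgK -mulgA -conjgE.
rewrite (partition_big (fun y => h^-1 ^ y)%g (mem (h^-1 ^: [set: gT])%g)) /=; last first.
  by move=> y _; rewrite imset_f ?inE.
rewrite /part_aug mulr_sumr; apply: eq_bigr => z /imsetP[y0 _ zE].
rewrite (eq_bigr (fun=> a z)) => [|y /eqP -> //].
rewrite sumr_const mulr_natl; congr (_ *+ _).
rewrite -(card_rcoset 'C[h] y0); apply: eq_card => y.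
transitivity (h^-1 ^ y == z)%g => //; rewrite mem_rcoset zE.
rewrite -(inj_eq (@conjg_inj _ y0^-1)%g) -!conjgM mulgV conjg1 conjVg (inj_eq invg_inj).
by apply/eqP/cent1P => [/conjg_fixP/commgP/commute_sym|/commute_sym/commgP/conjg_fixP].
Qed.

End Bimodule.

Lemma map_bimod_mx (gT : finGroupType) (R S : comNzRingType)
    (f : {rmorphism R -> S}) (a : {ffun gT -> R}) h :
  map_mx f (bimod_mx a h) = bimod_mx [ffun x => f (a x)] h.
Proof. by apply/matrixP => i j; rewrite !mxE ffunE. Qed.

Section FiniteOrderTrace.

Lemma cyclic_repr_proof n (A : 'M[algC]_n) q : A ^+ q.+1 = 1 ->
  mx_repr [set: 'I_q.+1] (fun i => A ^+ i).
Proof. by move=> A1; split=> // x y _ _; rewrite /= expr_mod // exprD. Qed.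

(** The powers of [A] represent a cyclic group, so [\tr A] is a character value: its modulus is at
    most the degree, with equality only for scalar matrices. *)
Lemma finite_order_trace n (A : 'M[algC]_n) m : (0 < m)%N -> A ^+ m = 1 ->
  `|\tr A| <= n%:R /\ (`|\tr A| = n%:R -> exists c, A = c%:M).
Proof.
case: m => // q _ A1; pose rG := MxRepresentation (cyclic_repr_proof A1).
(* [inZp] reduces modulo [q.+1]; for [q = 0] it gives 0, which still represents [A] because then
   [A = 1]. *)
pose x : 'I_q.+1 := inZp 1.
have rx : rG x = A by rewrite /= expr_mod // expr1.
have cx : cfRepr rG x = \tr A by rewrite cfunE rx inE.
have c1 : cfRepr rG 1%g = n%:R by rewrite cfRepr1.
split=> [|tA]; first by rewrite -cx -c1 char1_ge_norm ?cfRepr_char.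
have [] := @max_cfRepr_norm_scalar _ _ _ rG x (in_setT _); first by rewrite cx c1.
by move=> c _; rewrite rx; exists c.
Qed.

(** Over [algC] the equality case makes [A] scalar; its diagonal entries are equal integers with sum
    [e *+ n]. *)
Lemma finite_order_trace_int n (A : 'M[int]_n) m : (0 < m)%N -> A ^+ m = 1 ->
  `|\tr A| <= n%:R /\ (forall e, `|e| = 1 -> \tr A = e *+ n -> A = e%:M).
Proof.
move=> m0 A1; pose f : {rmorphism int -> algC} := intr.
have fA1 : (map_mx f A) ^+ m = 1 by rewrite -rmorphXn /= A1 rmorph1.
have [le eqn] := finite_order_trace m0 fA1.
have trE : `|\tr (map_mx f A)| = `|\tr A|%:~R by rewrite trace_map_mx -intr_norm.
split=> [|e e1 trA]; first by move: le; rewrite trE -[n%:R in X in _ <= X]/(n%:Z%:~R) ler_int natz.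
have [|c Ac] := eqn; first by rewrite trE trA normrMn e1 -[1 *+ n]/(n%:R) natz.
have AE i j : A i j = (if i == j then A i i else 0).
  case: eqP => [->//|/eqP/negPf nij]; move/matrixP/(_ i j): Ac.
  by rewrite !mxE nij mulr0n -[0 in RHS]/(0%:~R) => /intr_inj.
have Aii i j : A i i = A j j.
  have [/matrixP/(_ i i) + /matrixP/(_ j j)] := (Ac, Ac).
  by rewrite !mxE !eqxx => <- /intr_inj.
apply/matrixP => i j; rewrite AE !mxE; case: eqP => // _.
have : \tr A = A i i *+ n by rewrite /mxtrace (eq_bigr (fun=> A i i)) // sumr_const card_ord.
rewrite trA => /eqP; rewrite -subr_eq0 -mulrnBl mulrn_eq0 subr_eq0.
(* In dimension 0 there is no index [i]; otherwise [n] cancels. *)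
by case: n i {j Aii AE Ac trA trE eqn le fA1 A1} A => [[]|n] //= i A /eqP ->.
Qed.
End FiniteOrderTrace.

Section BermanHigman.
Variable gT : finGroupType.
Implicit Type u : {ffun gT -> int}.

Lemma part_aug1 u : part_aug u 1%g = u 1%g.
Proof. by rewrite /part_aug class1G big_set1. Qed.

(** Berman-Higman: left multiplication by [u] has trace [#|gT| * u 1], so [u 1] has absolute value
    at most 1, and if it is nonzero the multiplication is scalar. The augmentation then fixes the
    sign. *)
Lemma torsion_coef1 u : gr_torsion u -> augmentation u = 1 -> u 1%g != 0 ->
  u = gr_one gT int.
Proof.
case=> n [n0 un] aug1 u1; have := bimod_mxX u n; rewrite un bimod_mx1.
move=> /(finite_order_trace_int n0)[].
rewrite mxtrace_bimod invg1 part_aug1 cent11T cardsT.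
set N := #|gT|; have N0 : (0 < N)%N by apply/card_gt0P; exists 1%g.
rewrite normrM normr_nat ger_pMr ?ltr0n // => le1 /(_ (u 1%g)) H.
have nu1 : `|u 1%g| = 1 by apply/eqP; rewrite eq_le le1 -gtz0_ge1 normr_gt0.
have {}H := H nu1 (mulr_natl _ _); have uE x : u x = u 1%g *+ (x == 1%g).
  move/matrixP/(_ (enum_rank 1%g) (enum_rank x)): H.
  rewrite !mxE !enum_rankK !invg1 !mulg1 (inj_eq enum_rank_inj) => ->.
  by rewrite eq_sym.
have u11 : u 1%g = 1.
  rewrite -aug1 /augmentation (bigD1 1%g) //= big1 ?addr0 // => x /negPf nx.
  by rewrite uE nx.
by apply/ffunP => x; rewrite uE u11 !ffunE.
Qed.

Lemma gr_powM_central u z n : z \in 'Z([set: gT]) ->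
  gr_pow (gr_mul u (gr_of int z)) n = gr_mul (gr_pow u n) (gr_of int (z ^+ n)%g).
Proof.
move=> Zz; have zC x : (x * z = z * x)%g by case/centerP: Zz => _ ->; rewrite ?inE.
elim: n => [|n IH]; first by rewrite expg0 gr_mul1r.
rewrite !gr_powS IH expgS -gr_mul_of !gr_mulA; congr gr_mul.
rewrite -!gr_mulA; congr gr_mul; apply/ffunP => x.
by rewrite gr_mul_ofl gr_mul_ofr; congr (_ _); apply: (mulgI z); rewrite mulKVg -zC mulgKV.
Qed.

(** Translation by the central [z^-1] moves the coefficient at [z] to the identity and keeps the
    order finite. *)
Lemma torsion_coef_central u z : gr_torsion u -> augmentation u = 1 ->
  z \in 'Z([set: gT]) -> u z != 0 -> u = gr_of int z.
Proof.
move=> [n [n0 un]] aug1 Zz uz; set v := gr_mul u (gr_of int z^-1%g).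
have Vz : z^-1%g \in 'Z([set: gT]) by rewrite groupV.
suff -> : u = gr_mul v (gr_of int z).
  suff -> : v = gr_one gT int by rewrite gr_mul1l.
  apply: torsion_coef1.
  - exists (n * #[z^-1])%N; rewrite muln_gt0 n0 order_gt0; split => //.
    rewrite gr_powM_central // mulnC expgM expg_order expg1n gr_mul1r.
    by rewrite mulnC gr_powM un gr_pow_one.
  - rewrite -aug1 /augmentation (reindex_inj (mulIg z^-1)%g) /=.
    by apply: eq_bigr => x _; rewrite gr_mul_ofr mulgK.
  - by rewrite gr_mul_ofr invgK mul1g.
by rewrite gr_mulA gr_mul_of mulVg gr_mul1r.
Qed.
End BermanHigman.

(** * Partial augmentations of p-th powers *)

Section PowerCongruence.

(** Splitting by values replaces a weighted sum by cardinalities, to which orbit counting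
    applies. *)
Lemma sum_levels (T : finType) (P : pred T) (F : T -> int) :
  \sum_(t | P t) F t = \sum_(v <- undup (codom F)) v *+ #|[set t | P t & F t == v]|.
Proof.
have -> : \sum_(t | P t) F t = \sum_(v <- undup (codom F)) \sum_(t | P t && (F t == v)) F t.
  rewrite (exchange_big_dep P) /= => [|v t _ /andP[]//].
  apply: eq_bigr => t Pt; under eq_bigl do rewrite Pt /=.
  rewrite -big_filter (_ : filter _ _ = [:: F t]) ?big_seq1 //.
  rewrite (@eq_filter _ _ (pred1 (F t))) => [|v]; last by rewrite /= eq_sym.
  by rewrite filter_pred1_uniq ?undup_uniq // mem_undup codom_f.
apply: eq_bigr => v _; rewrite (eq_bigr (fun=> v)) => [|t /andP[_ /eqP]//].
by rewrite sumr_const; congr (_ *+ _); apply: eq_card => t; rewrite inE.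
Qed.

(** [s] generates a cyclic [p]-group acting on each level set of [F], and the size of a level set is
    congruent to its number of fixed points. *)
Lemma prime_period_sum (T : finType) (s : T -> T) p (F : T -> int) :
    prime p -> (forall t, iter p s t = t) -> (forall t, F (s t) = F t) ->
  (\sum_t F t)%:~R = (\sum_(t | s t == t) F t)%:~R :> 'F_p.
Proof.
move=> p_pr sp Fs; have s_inj : injective s.
  apply: (@can_inj _ _ _ (iter p.-1 s)) => t; rewrite -iterSr prednK ?prime_gt0 //.
pose g := perm s_inj; have gp : (g ^+ p = 1)%g.
  by apply/permP => t; rewrite permX perm1 -[RHS]sp; apply: eq_iter => x; rewrite permE.
have pG : p.-group <[g]> by rewrite /pgroup -orderE (pnat_dvd _ (pnat_id p_pr)) // order_dvdn gp.
rewrite !sum_levels !rmorph_sum; apply: eq_bigr => v _.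
rewrite !rmorphMn -[LHS]mulr_natr -[RHS]mulr_natr; congr (_ * _).
set S := [set t | true & F t == v].
have acts : [acts <[g]>, on S | 'P].
  rewrite cycle_subG; apply/astabsP => t.
  by rewrite /= apermE !inE permE Fs.
have := pgroup_fix_mod pG acts; rewrite afix_cycle ?inE // => mod_eq.
have <- : #|'Fix_(S | 'P)[g]| = #|[set t | s t == t & F t == v]|.
  apply: eq_card => t; by rewrite !inE sub1set inE /= apermE permE andbC.
by rewrite -[LHS]Fp_nat_mod // mod_eq Fp_nat_mod.
Qed.

Variable gT : finGroupType.
Implicit Type u : {ffun gT -> int}.

Lemma sum_gr_pow u n (F : gT -> int) :
  \sum_x gr_pow u n x * F x =
  \sum_(t : n.-tuple gT) (\prod_(x <- t) u x) * F (\prod_(x <- t) x)%g.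
Proof.
elim: n F => [|n IH] F.
  rewrite (bigD1 1%g) //= ffunE eqxx mul1r big1 => [|x /negPf nx]; last first.
    by rewrite ffunE nx mul0r.
  rewrite addr0 (big_pred1 [tuple]) => [|t]; last by rewrite [t]tuple0; apply/esym/eqP.
  by rewrite !big_nil mul1r.
rewrite gr_powS (sum_gr_mul (V := int^o) F).
transitivity (\sum_y u y * \sum_z gr_pow u n z * F (y * z)%g).
  by apply: eq_bigr => y _; rewrite mulr_sumr; apply: eq_bigr => z _; rewrite mulrA.
under eq_bigr => y _ do rewrite (IH (fun z => F (y * z)%g)) mulr_sumr.
rewrite pair_big_dep /=.
rewrite [RHS](reindex (fun q : gT * n.-tuple gT => [tuple of q.1 :: q.2])) /=; last first.
  exists (fun t => (thead t, [tuple of behead t])) => [[x t] _|t _] /=.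
    by rewrite theadE; congr (_, _); apply: val_inj.
  by rewrite -tuple_eta.
by apply: eq_bigr => -[x t] _ /=; rewrite !big_cons mulrA.
Qed.

Lemma rot1_constant (T : eqType) (x : T) s : rot 1 (x :: s) = x :: s -> s = nseq (size s) x.
Proof.
rewrite rot1_cons; elim: s x => //= y s IH x [-> e].
by congr cons; apply: IH.
Qed.

Lemma intr_Fp_expp p (z : int) : prime p -> (z ^+ p)%:~R = z%:~R :> 'F_p.
Proof.
by move=> p_pr; rewrite rmorphXn /=; have := expf_card (z%:~R : 'F_p); rewrite card_Fp.
Qed.

(** Expand the power over [p]-tuples. Rotation preserves each summand because [F] takes equal values
    at [x * y] and [y * x]; the fixed tuples are constant and contribute [u x ^+ p], which is [u x]
    modulo [p] by Fermat. *)
Lemma gr_pow_congr u p (F : gT -> int) : prime p ->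
    (forall x y, F (x * y)%g = F (y * x)%g) ->
  (p %| (\sum_x gr_pow u p x * F x) - \sum_x u x * F (x ^+ p)%g)%Z.
Proof.
move=> p_pr FC; have p0 := prime_gt0 p_pr.
rewrite (dvdz_pcharf (pchar_Fp p_pr)) rmorphB subr_eq0 /= sum_gr_pow.
pose s (t : p.-tuple gT) := [tuple of rot 1 t].
have iter_s k (t : p.-tuple gT) : (k <= p)%N -> val (iter k s t) = rot k t.
  elim: k => [|k IH] kp; first by rewrite rot0.
  by rewrite iterS /= IH 1?ltnW // -rotS ?size_tuple.
rewrite (@prime_period_sum _ s) //; first 1 last.
- by move=> t; apply: val_inj; rewrite iter_s // -{1}(size_tuple t) rot_size.
- case=> [[|x t] tp] //=; rewrite rot1_cons -cats1 !big_cat !big_seq1 !big_cons /=.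
  by rewrite FC [X in X * _ = _]mulrC.
pose c x : p.-tuple gT := [tuple of nseq p x].
rewrite (reindex c) /=; last first.
  exists (fun t => nth 1%g t 0) => [x _|t]; first by rewrite /= nth_nseq p0.
  rewrite inE => /eqP/(congr1 val) /= st; apply: val_inj => /=.
  case: t st => [[|x t] /= tp] st; first by move: p0; rewrite -(eqP tp).
  by rewrite -(eqP tp) /= -(rot1_constant st).
rewrite !rmorph_sum /=; apply/eqP.
rewrite (eq_bigl predT) => [|x]; last first.
  apply/eqP/val_inj; rewrite /= -(prednK p0) /= rot1_cons.
  by elim: p.-1 => //= k ->.
apply: eq_bigr => x _; rewrite !rmorphM /=; congr (_ * _); last first.
  by congr (F _)%:~R; rewrite big_nseq iter_mulg mulg1.
by rewrite big_nseq iter_mulr mulr1 intr_Fp_expp.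
Qed.

Lemma part_aug_congr u p c : prime p ->
  (p %| part_aug (gr_pow u p) c - \sum_(x | (x ^+ p \in c ^: [set: gT])%g) u x)%Z.
Proof.
move=> p_pr; pose F (x : gT) : int := (x \in c ^: [set: gT])%:R.
have := @gr_pow_congr u p F p_pr.
have E (P : pred gT) (v : gT -> int) : \sum_x v x * (P x)%:R = \sum_(x | P x) v x.
  by rewrite [RHS]big_mkcond; apply: eq_bigr => x _; case: (P x); rewrite ?mulr1 ?mulr0.
rewrite !E; apply => x y; rewrite /F; congr (_%:R); congr nat_of_bool.
have -> : (y * x = (x * y) ^ x)%g by rewrite conjgE -mulgA mulKg.
by rewrite [RHS]class_sym classGidl ?inE // class_sym.
Qed.
End PowerCongruence.

(** * Conjugacy in the rational group algebra *)

Section ClassLike.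
Variable gT : finGroupType.
Implicit Type u : {ffun gT -> int}.

Definition class_like u (g : gT) :=
  forall x, part_aug u x = (x \in g ^: [set: gT])%:R.

Definition torsion_class_like :=
  forall u, gr_torsion u -> augmentation u = 1 -> exists g, class_like u g.

Lemma class_like_of g : class_like (gr_of int g) g.
Proof.
move=> x; rewrite /part_aug class_sym; case: (boolP (g \in _)) => [gx|ngx].
  rewrite (bigD1 g) //= ffunE eqxx big1 ?addr0 // => y /andP[_ /negPf ny].
  by rewrite ffunE ny.
rewrite big1 // => y yx; rewrite ffunE; case: eqP => // yg.
by rewrite -yg yx in ngx.
Qed.

Lemma sum_class_like u g (Q : pred gT) : class_like u g ->
  (forall x y, Q (x ^ y)%g = Q x) -> \sum_(x | Q x) u x = (Q g)%:R.
Proof.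
move=> ug QJ; rewrite (partition_big (fun x => x ^: [set: gT]) (mem (classes [set: gT]))) /=; last first.
  by move=> x _; rewrite mem_classes ?inE.
have sumE C : C \in classes [set: gT] ->
    \sum_(x | Q x && (x ^: [set: gT] == C)) u x = (Q g && (C == g ^: [set: gT]))%:R.
  case/imsetP=> x0 _ ->.
  have QE x : x \in x0 ^: [set: gT] -> Q x = Q x0 by case/imsetP=> z _ ->; rewrite QJ.
  transitivity ((Q x0)%:R * part_aug u x0).
    rewrite /part_aug mulr_sumr big_mkcondl (eq_bigl (mem (x0 ^: [set: gT]))) => [|x]; last first.
      by rewrite (sameP eqP class_eqP).
    by apply: eq_bigr => x /QE ->; case: (Q x0); rewrite ?mul1r ?mul0r.
  rewrite ug (sameP class_eqP eqP).
  case: eqP => [/class_eqP x0g|_]; last by rewrite mulr0 andbF.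
  by rewrite mulr1 andbT; case/imsetP: x0g => z _ ->; rewrite QJ.
rewrite (eq_bigr _ sumE) (bigD1 (g ^: [set: gT])) ?mem_classes ?inE //= eqxx andbT.
by rewrite big1 ?addr0 // => C /andP[_ /negPf ->]; rewrite andbF.
Qed.

Lemma class_like_coef1 u g : class_like u g -> (u 1%g == 0) = (g != 1%g).
Proof.
move=> /(_ 1%g); rewrite part_aug1 => ->; rewrite class_sym class1G inE.
by case: (g == 1%g).
Qed.

Lemma class_likeP u g h : class_like u g -> h \in g ^: [set: gT] -> class_like u h.
Proof. by move=> ug hg x; rewrite ug (class_eqP hg). Qed.

Hypothesis clike : torsion_class_like.

(** By [clike] the power is class-like for some [h]. Its partial augmentation at [g^p] is 0 or 1 and
    congruent to 1 modulo [p], so [h] is conjugate to [g^p]. *)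
Lemma class_like_expp u g p : prime p -> gr_torsion u -> augmentation u = 1 ->
  class_like u g -> class_like (gr_pow u p) (g ^+ p)%g.
Proof.
move=> p_pr tu au ug.
have [|h hP] := clike (gr_torsion_pow p tu); first by rewrite augmentation_pow au expr1n.
apply: (class_likeP hP); have := part_aug_congr u (g ^+ p)%g p_pr.
rewrite hP (@sum_class_like u g) // => [|x y]; last first.
  by rewrite -conjXg class_sym classGidl ?inE // class_sym.
rewrite class_refl; case: (_ \in _) => //; rewrite sub0r dvdzE abszN /= dvdn1.
by move=> /eqP p1; rewrite p1 in p_pr.
Qed.

Lemma class_like_exp u g k : gr_torsion u -> augmentation u = 1 ->
  class_like u g -> class_like (gr_pow u k) (g ^+ k)%g.
Proof.
elim/ltn_ind: k u g => -[|[|k]] IH u g tu au ug; first exact: class_like_of.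
  by rewrite gr_pow1.
(* Split off the least prime factor of the exponent and apply the induction hypothesis to [u^p]. *)
set p := pdiv k.+2; have p_pr : prime p by apply: pdiv_prime.
have /dvdnP[m kE] : (p %| k.+2)%N := pdiv_dvd _.
rewrite kE mulnC gr_powM expgM; apply: IH; last exact: class_like_expp.
- rewrite kE -[X in (X < _)%N]muln1 ltn_pmul2l ?prime_gt1 //.
  by case: m kE.
- exact: gr_torsion_pow.
- by rewrite augmentation_pow au expr1n.
Qed.

End ClassLike.

Section Intertwine.
Variables (gT : finGroupType) (R : comNzRingType).
Implicit Types (a b v : {ffun gT -> R}).

Lemma bimod_mx_inj : injective (fun a => bimod_mx a 1%g).
Proof.
move=> a b /matrixP e; apply/ffunP => x.
by have := e (enum_rank 1%g) (enum_rank x); rewrite !mxE !enum_rankK !invg1 !mulg1.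
Qed.

(** When [a^n = 1], the factor [a^(n-k)] is [a^-k], so this is the sum of [g^k v a^-k]. Up to the
    factor [n] it projects onto the solutions [w] of [w a = g w]. *)
Definition gr_avg a (g : gT) n v : {ffun gT -> R} :=
  [ffun x => \sum_(k < n) gr_mul (gr_of R (g ^+ k)%g) (gr_mul v (gr_pow a (n - k))) x].

Lemma gr_avg_intertwine a g n v : (0 < n)%N -> gr_pow a n = gr_one gT R -> (g ^+ n = 1)%g ->
  gr_mul (gr_avg a g n v) a = gr_mul (gr_of R g) (gr_avg a g n v).
Proof.
move=> n0 an gn; apply/ffunP => x; rewrite gr_mul_ofl !ffunE.
under eq_bigr do rewrite ffunE mulr_suml.
rewrite exchange_big /=.
have E k : (k < n)%N -> \sum_y gr_mul (gr_of R (g ^+ k)%g) (gr_mul v (gr_pow a (n - k))) y * a (y^-1 * x)%g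
   = gr_mul (gr_of R (g ^+ k)%g) (gr_mul v (gr_pow a (n - k).+1)) x.
  move=> _; rewrite gr_powSr -!gr_mulA [RHS]ffunE; apply: eq_bigr => y _.
  by rewrite !gr_mulA.
have E' k : gr_mul (gr_of R (g ^+ k)%g) (gr_mul v (gr_pow a (n - k))) (g^-1 * x)%g
   = gr_mul (gr_of R (g ^+ k.+1)%g) (gr_mul v (gr_pow a (n - k))) x.
  by rewrite expgS -gr_mul_of gr_mulA [RHS]gr_mul_ofl.
under eq_bigr => k _ do rewrite E //.
under [RHS]eq_bigr => k _ do rewrite E' //.
case: n n0 an gn {E E'} => // n _ an gn.
(* A shift of [k] matches all terms but the first on the left and the last on the right; these agree
   by [a^n = 1] and [g^n = 1]. *)
rewrite big_ord_recl [RHS]big_ord_recr addrC; congr (_ + _).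
  by apply: eq_bigr => k _; rewrite /= /bump /= add1n subSS subSn // ltnW.
by rewrite gn expg0 subn0 subSnn gr_powS an gr_pow1 gr_mul1r.
Qed.

Lemma gr_avg_id a g n w : gr_mul w a = gr_mul (gr_of R g) w -> gr_pow a n = gr_one gT R ->
  gr_avg a g n w = [ffun x => n%:R * w x].
Proof.
move=> wa an; have wak k : gr_mul (gr_of R (g ^+ k)%g) w = gr_mul w (gr_pow a k).
  elim: k => [|k IH]; first by rewrite gr_mul1l gr_mul1r.
  by rewrite expgSr -gr_mul_of gr_mulA -wa -gr_mulA IH gr_mulA -gr_powSr.
apply/ffunP => x; rewrite !ffunE (eq_bigr (fun=> w x)) => [|k _].
  by rewrite sumr_const card_ord mulr_natl.
by rewrite -gr_mulA wak gr_mulA -gr_powD subnKC ?(ltnW (ltn_ord k)) // an gr_mul1r.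
Qed.

Lemma gr_avgD a g n v v' (t : R) :
  gr_avg a g n [ffun x => v x + t * v' x] =
  [ffun x => gr_avg a g n v x + t * gr_avg a g n v' x].
Proof.
apply/ffunP => x; rewrite !ffunE mulr_sumr -big_split; apply: eq_bigr => k _ /=.
rewrite !gr_mul_ofl !ffunE mulr_sumr -big_split; apply: eq_bigr => y _ /=.
by rewrite ffunE mulrDl mulrA.
Qed.

Lemma bimod_mxD a b (t : R) h :
  bimod_mx [ffun x => a x + t * b x] h = bimod_mx a h + t *: bimod_mx b h.
Proof. by apply/matrixP => i j; rewrite !mxE !ffunE. Qed.

End Intertwine.

Section RingMap.
Variables (gT : finGroupType) (R S : comNzRingType) (f : {rmorphism R -> S}).
Implicit Types (a b : {ffun gT -> R}).
Definition gr_map a : {ffun gT -> S} := [ffun x => f (a x)].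

Lemma gr_map_of (g : gT) : gr_map (gr_of R g) = gr_of S g.
Proof. by apply/ffunP => x; rewrite !ffunE rmorph_nat. Qed.

Lemma gr_map_mul a b : gr_map (gr_mul a b) = gr_mul (gr_map a) (gr_map b).
Proof.
apply/ffunP => x; rewrite !ffunE rmorph_sum; apply: eq_bigr => y _.
by rewrite !ffunE rmorphM.
Qed.

Lemma gr_map_pow a n : gr_map (gr_pow a n) = gr_pow (gr_map a) n.
Proof.
by elim: n => [|n IH]; [exact: gr_map_of | rewrite !gr_powS gr_map_mul IH].
Qed.

Lemma gr_map_avg a g n v : gr_map (gr_avg a g n v) = gr_avg (gr_map a) g n (gr_map v).
Proof.
apply/ffunP => x; rewrite !ffunE rmorph_sum; apply: eq_bigr => k _.
by rewrite -gr_map_of -gr_map_pow -!gr_map_mul [in RHS]ffunE.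
Qed.

Lemma part_aug_map a x : part_aug (gr_map a) x = f (part_aug a x).
Proof. by rewrite rmorph_sum; apply: eq_bigr => y _; rewrite ffunE. Qed.
End RingMap.

Section Conjugacy.

Lemma poly_nat_nonroot (R : numDomainType) (p : {poly R}) : p != 0 ->
  exists k : nat, p.[k%:R] != 0.
Proof.
move=> p0; set rs := [seq k%:R : R | k <- iota 0 (size p)].
have /allPn[_ /mapP[k _ ->] nk] : ~~ all (root p) rs.
  apply/negP => /(max_poly_roots p0); rewrite map_inj_uniq ?iota_uniq; last exact: mulrIn (oner_neq0 _).
  by rewrite size_map size_iota ltnn => /(_ isT).
by exists k.
Qed.

Variable gT : finGroupType.

(** The determinant is polynomial in each coefficient of [v], so the coefficients can be made
    natural numbers one at a time without reaching a zero. *)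
Lemma nat_coef_det n (L : {ffun gT -> algC} -> 'M[algC]_n) (v : {ffun gT -> algC}) :
    (forall (v v' : {ffun gT -> algC}) t, L [ffun x => v x + t * v' x] = L v + t *: L v') ->
    \det (L v) != 0 ->
  exists m : gT -> nat, \det (L [ffun x => (m x)%:R]) != 0.
Proof.
move=> LD dv.
suff [v' dv' nv'] : exists2 v', \det (L v') != 0 & forall x, v' x \in Num.nat.
  exists (fun x => Num.trunc (v' x)); rewrite (_ : [ffun x => _] = v') //.
  by apply/ffunP => x; rewrite ffunE truncK.
suff [v' dv' nv'] : exists2 v', \det (L v') != 0
    & forall x, x \in enum gT -> v' x \in Num.nat.
  by exists v' => // x; rewrite nv' ?mem_enum.
elim: (enum gT) => [|x s [v' dv' nv']]; first by exists v.
pose A := map_mx polyC (L v') + 'X *: map_mx polyC (L (gr_of _ x)).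
have AE t : (\det A).[t] = \det (L [ffun y => v' y + t * gr_of algC x y]).
  rewrite LD -horner_evalE -det_map_mx; congr (\det _); apply/matrixP => i j.
  by rewrite /A !mxE /= horner_evalE !hornerE.
have A0 : \det A != 0.
  apply: contraNneq dv' => A0; have := AE 0; rewrite A0 horner0 => ->.
  by apply/eqP; congr (\det (L _)); apply/ffunP => y; rewrite ffunE mul0r addr0.
(* After this substitution the variable is the new coefficient at [x] itself, not its increment. *)
have /poly_nat_nonroot[k] : \det A \Po ('X - (v' x)%:P) != 0.
  by rewrite comp_poly2_eq0 // size_XsubC.
rewrite horner_comp !hornerE AE => dk; eexists; first exact: dk.
move=> y; rewrite inE !ffunE; case: eqP => [-> _|ny /= ys].
  by rewrite mulr1 subrKC.
by rewrite mulr0 addr0 nv'.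
Qed.

Section Algebraic.
Variables (a : {ffun gT -> algC}) (q : nat).
Hypothesis aq : gr_pow a q.+1 = gr_one gT algC.

Lemma gr_pow_modn k : gr_pow a (k %% q.+1) = gr_pow a k.
Proof.
by rewrite [in RHS](divn_eq k q.+1) gr_powD mulnC gr_powM aq gr_pow_one gr_mul1l.
Qed.

(** CG as a module: the cyclic factor acts by powers of [a] on the left, the group on the right. *)
Lemma bimod_repr_proof :
  mx_repr [set: 'I_q.+1 * gT] (fun z => bimod_mx (gr_pow a z.1) z.2).
Proof.
split=> [|y z _ _] /=; first exact: bimod_mx1.
by rewrite bimod_mxM -gr_powD gr_pow_modn addnC.
Qed.

Definition bimod_repr := MxRepresentation bimod_repr_proof.
End Algebraic.

(** An endomorphism commuting with right multiplications is left multiplication by the image of 1,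
    which is the row of [B] at the identity. *)
Lemma commuting_bimod (B : 'M[algC]_#|gT|) :
    (forall h, bimod_mx (gr_one gT algC) h *m B = B *m bimod_mx (gr_one gT algC) h) ->
  B = bimod_mx [ffun x => B (enum_rank 1%g) (enum_rank x)] 1%g.
Proof.
move=> BC; apply/matrixP => i j; rewrite !mxE ffunE invg1 mulg1.
have /matrixP/(_ (enum_rank 1%g) j) := BC (enum_val i); rewrite !mxE.
rewrite (bigD1 i) //= mxE ffunE enum_rankK invg1 mulg1 mulgV eqxx mul1r.
rewrite big1 ?addr0 => [->|k /negPf ki]; last first.
  rewrite mxE ffunE enum_rankK invg1 mulg1 -eq_mulgV1 (inj_eq enum_val_inj) ki.
  by rewrite mul0r.
set k0 := enum_rank (_ * _)%g; rewrite (bigD1 k0) //= mxE ffunE /k0 enum_rankK.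
rewrite mulgV eqxx mulr1 big1 ?addr0 // => k /negPf nk.
rewrite mxE ffunE -eq_mulgV1 -(inj_eq enum_rank_inj) enum_valK eq_sym nk.
by rewrite mulr0.
Qed.

(** Equal partial augmentations of powers mean equal characters, hence isomorphic modules.
    Compatibility with the group makes the isomorphism a left multiplication by [w]; compatibility
    with the cyclic factor gives [w a = b w]. *)
Lemma algC_conjugate (a b : {ffun gT -> algC}) n : (0 < n)%N ->
    gr_pow a n = gr_one gT algC -> gr_pow b n = gr_one gT algC ->
    (forall k x, part_aug (gr_pow a k) x = part_aug (gr_pow b k) x) ->
  exists2 w, gr_mul w a = gr_mul b w & bimod_mx w 1%g \in unitmx.
Proof.
case: n => // q _ aq bq ab.
have /cfRepr_inj[B _ freeB BC] : cfRepr (bimod_repr aq) = cfRepr (bimod_repr bq).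
  apply/cfunP => -[k h]; rewrite !cfunE /=; congr (_ *+ _).
  by rewrite !mxtrace_bimod ab.
pose w : {ffun gT -> algC} := [ffun x => B (enum_rank 1%g) (enum_rank x)].
have Bw : B = bimod_mx w 1%g.
  by apply: commuting_bimod => h; have := BC (1%g, h) (in_setT _).
exists w; last by rewrite -Bw -row_free_unit.
apply: bimod_mx_inj; have := BC (inZp 1, 1%g) (in_setT _).
by rewrite /= !gr_pow_modn // !gr_pow1 Bw !bimod_mxM !mulg1.
Qed.

(** The row of the inverse matrix at the identity holds a right inverse of [w]; for matrices a
    one-sided inverse is two-sided. *)
Lemma bimod_unit_inv (R : comUnitRingType) (w : {ffun gT -> R}) : bimod_mx w 1%g \in unitmx ->
  exists w', gr_mul w w' = gr_one gT R /\ gr_mul w' w = gr_one gT R.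
Proof.
move=> uw; set e := bimod_mx w 1%g.
pose w' : {ffun gT -> R} := [ffun x => invmx e (enum_rank 1%g) (enum_rank x)].
have ww' : gr_mul w w' = gr_one gT R.
  apply/ffunP => x; have /matrixP/(_ (enum_rank 1%g) (enum_rank x)) := mulVmx uw.
  rewrite !mxE (inj_eq enum_rank_inj) eq_sym => E; rewrite [RHS]ffunE -E ffunE {E}.
  rewrite (reindex_inj invg_inj) (reindex_inj (mulIg x^-1)%g) /=.
  rewrite (reindex (fun i : 'I_#|gT| => enum_val i)) /=; last first.
    by exists enum_rank => z _; rewrite ?enum_valK ?enum_rankK.
  apply: eq_bigr => i _; rewrite !ffunE !mxE enum_rankK invg1 mulg1.
  by rewrite invgK mulgKV enum_valK invMg invgK mulrC.
exists w'; split=> //; apply: bimod_mx_inj; rewrite bimod_mx1.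
rewrite -{1}(mulg1 1%g) -bimod_mxM; apply: mulmx1C.
by rewrite bimod_mxM mulg1 ww' bimod_mx1.
Qed.

(** Descent to the rationals: averaging is linear and sends the complex intertwiner [w] to [n w],
    which is invertible. So some [v] with natural coefficients also has an invertible average, and
    that average is rational. *)
Lemma rat_conjugate (a : {ffun gT -> rat}) (g : gT) n : (0 < n)%N ->
    gr_pow a n = gr_one gT rat -> (g ^+ n = 1)%g ->
    (forall k x, part_aug (gr_pow a k) x = part_aug (gr_of rat (g ^+ k)%g) x) ->
  QG_conjugate a (gr_of rat g).
Proof.
move=> n0 an gn ag; pose f : {rmorphism rat -> algC} := ratr.
have fan : gr_pow (gr_map f a) n = gr_one gT algC by rewrite -gr_map_pow an gr_map_of.
have [|k x|w wa uw] := @algC_conjugate (gr_map f a) (gr_of algC g) n n0 fan.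
- by rewrite gr_pow_of gn.
- by rewrite -(gr_map_of f) -!gr_map_pow !part_aug_map ag gr_pow_of.
pose L v := bimod_mx (gr_avg (gr_map f a) g n v) 1%g.
have LD (v v' : {ffun gT -> algC}) t : L [ffun x => v x + t * v' x] = L v + t *: L v'.
  by rewrite /L gr_avgD bimod_mxD.
have Lw : L w = n%:R *: bimod_mx w 1%g.
  by rewrite /L gr_avg_id //; apply/matrixP => i j; rewrite !mxE ffunE.
have [|m dm] := nat_coef_det LD (v := w).
  rewrite Lw detZ mulf_neq0 ?expf_neq0 ?pnatr_eq0 -?lt0n //.
  by rewrite -unitfE -unitmxE.
pose v := gr_avg a g n [ffun x => (m x)%:R].
have uv : bimod_mx v 1%g \in unitmx.
  rewrite unitmxE unitfE; apply: contraNneq dm => dv; apply/eqP.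
  rewrite /L (_ : [ffun x => (m x)%:R] = gr_map f [ffun x => (m x)%:R]); last first.
    by apply/ffunP => x; rewrite !ffunE rmorph_nat.
  by rewrite -gr_map_avg -map_bimod_mx det_map_mx dv rmorph0.
have [v' [vv' v'v]] := bimod_unit_inv uv; exists v', v; split=> //.
by rewrite -gr_mulA gr_avg_intertwine // gr_mulA vv' gr_mul1r.
Qed.

Theorem class_like_conjugate (u : {ffun gT -> int}) : torsion_class_like gT ->
  gr_torsion u -> augmentation u = 1 -> exists g, QG_conjugate (gr_ZtoQ u) (gr_of rat g).
Proof.
move=> clike tu au; have [g ug] := clike u tu au; exists g.
have ugk := class_like_exp clike _ tu au ug; case: tu => n [n0 un].
pose f : {rmorphism int -> rat} := intr.
have ua : gr_ZtoQ u = gr_map f u by [].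
apply: (@rat_conjugate _ _ n) => //.
- by rewrite ua -gr_map_pow un gr_map_of.
(* [g^n = 1] is read off from the coefficient of [u^n = 1] at the identity. *)
- have := class_like_coef1 (ugk n); rewrite un ffunE eqxx oner_eq0.
  by move/esym/negbFE/eqP.
move=> k x; rewrite ua -gr_map_pow -(gr_map_of f) !part_aug_map; congr (f _).
by rewrite ugk class_like_of.
Qed.

End Conjugacy.

(** * Groups with large classes and central extensions *)

Section Quotient.
Variable gT : finGroupType.
Local Notation T := [set: gT].

Lemma torsion_abelian (u : {ffun gT -> int}) : abelian T ->
  gr_torsion u -> augmentation u = 1 -> exists g, u = gr_of int g.
Proof.
move=> abT tu au; have [g ug] : exists g, u g != 0.
  apply/existsP; rewrite -negb_forall; apply/negP => /forallP u0.
  by move: au; rewrite /augmentation big1 // => x _; apply/eqP/u0.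
by exists g; apply: torsion_coef_central => //; rewrite (center_idP abT) inE.
Qed.

Lemma coset_of_setT (K : {group gT}) : T \subset 'N(K) -> [set: coset_of K] = (T / K)%g.
Proof.
move=> nK; apply/setP => xb; have [x Nx ->] := cosetP xb.
by rewrite inE mem_quotient ?inE.
Qed.

Lemma quo_mul (K : {group gT}) : T \subset 'N(K) ->
  forall x y, coset K (x * y)%g = (coset K x * coset K y)%g.
Proof. by move=> nK x y; rewrite morphM // (subsetP nK) ?inE. Qed.

Lemma quo_eq (K : {group gT}) x y : T \subset 'N(K) ->
  (coset K x == coset K y) = ((x^-1 * y)%g \in K).
Proof.
move=> nK; have N z : z \in 'N(K) by rewrite (subsetP nK) ?inE.
apply/eqP/idP => [e|xy]; first by rewrite coset_idr // quo_mul // morphV //= e mulVg.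
by apply: (mulgI (coset K x)^-1%g); rewrite mulVg -morphV // -quo_mul // coset_id.
Qed.

End Quotient.

Section CosetConj.
Variable gT : finGroupType.
Local Notation T := [set: gT].

Definition coset_conj := forall x y : gT, x \notin 'Z(T) -> y \notin 'Z(T) ->
  (x^-1 * y)%g \in T^`(1)%g -> y \in x ^: T.

(** A nonzero central coefficient is settled by Berman-Higman. Otherwise a noncentral class differs
    from its coset of the derived subgroup only by central elements, where [u] vanishes; so partial
    augmentations are coefficients of the image over the abelianization, which is a group
    element. *)
Lemma coset_conj_class_like : coset_conj -> torsion_class_like gT.
Proof.
move=> CC u tu au; set D := T^`(1)%G; have nD : T \subset 'N(D) := der_norm 1 _.
have [z /andP[Zz uz]|noz] := pickP (fun z => (z \in 'Z(T)) && (u z != 0)).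
  by exists z; rewrite (torsion_coef_central tu au Zz uz); apply: class_like_of.
have u0 z : z \in 'Z(T) -> u z = 0 by move=> Zz; have := noz z; rewrite Zz => /negbFE/eqP.
have abD : abelian [set: coset_of D].
  by rewrite coset_of_setT //; have := der_abelian 0 [set: gT]%G; rewrite derg0.
have fM := quo_mul nD; pose v := gr_push (coset D) (fun=> 1) u.
have [||gb vE] := @torsion_abelian _ v abD.
- by apply: gr_torsion_push => // *; rewrite mulr1.
- by rewrite augmentation_push -augmentation_waug.
have fib y : \sum_(x | coset D x == y) u x = (y == gb)%:R.
  have := congr1 (fun w : {ffun _ -> int} => w y) vE; rewrite !ffunE => <-.
  by apply: eq_bigr => x _; rewrite mulr1.
have [x0 /andP[x0D ux0]] : exists x0, (coset D x0 == gb) && (u x0 != 0).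
  apply/existsP; rewrite -[X in is_true X]negbK negb_exists; apply/negP => /forallP H.
  have := fib gb; rewrite eqxx big1 // => x xg.
  by have := H x; rewrite xg => /negbNE/eqP.
have nZx0 : x0 \notin 'Z(T) by apply: contraNN ux0 => /u0 ->.
exists x0 => x; case: (boolP (x \in 'Z(T))) => Zx.
  have xT : x ^: T = [set x].
    apply/setP => y; rewrite inE; apply/imsetP/eqP => [[z _ ->]|->]; last first.
      by exists 1%g; rewrite ?inE ?conjg1.
    by rewrite conjgE; case/centerP: Zx => _ /(_ z (in_setT _)) ->; rewrite mulKg.
  rewrite /part_aug xT big_set1 u0 // class_sym xT inE.
  by case: eqP => // e; rewrite e Zx in nZx0.
have -> : part_aug u x = \sum_(y | coset D y == coset D x) u y.
  rewrite /part_aug [RHS](bigID (fun y => y \in 'Z(T))) /=.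
  rewrite [X in _ = X + _]big1 ?add0r => [|y /andP[_ /u0]//].
  apply: eq_bigl => y; apply/idP/andP => [/imsetP[z _ ->]|[]].
    split; last by rewrite memJ_norm // (subsetP (normal_norm (center_normal [set: gT]%G))) ?inE.
    by rewrite eq_sym quo_eq // -commgEl mem_commg ?inE.
  by rewrite eq_sym quo_eq // => xy Zy; apply: CC.
rewrite fib -(eqP x0D); congr (_%:R); congr nat_of_bool.
apply/eqP/idP => [e|/imsetP[z _ ->]].
  by apply: CC => //; rewrite -quo_eq // e.
by apply/eqP; rewrite eq_sym quo_eq // -commgEl mem_commg ?inE.
Qed.

Lemma class_gt1 (x : gT) : x \notin 'Z(T) -> (1 < #|x ^: T|)%N.
Proof.
apply: contraNltn; rewrite -index_cent1 => le1.
have /eqP : #|T : 'C_T[x]| = 1%N by apply/eqP; rewrite eqn_leq le1 indexg_gt0.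
rewrite indexg_eq1 subsetI subxx /= => /subsetP TC.
by apply/centerP; split=> [|y yT]; rewrite ?inE //; apply/esym/cent1P/TC.
Qed.

(** Two distinct noncentral classes in one coset have at least 2 elements each, so the derived
    subgroup has order at least 4. If the order is 4, the centralizer of [x] has index 2 and
    contains the derived subgroup, whose index is then even. *)
Lemma small_der_coset_conj :
  (#|T^`(1)%g| <= 3)%N \/ (#|T^`(1)%g| = 4%N /\ odd #|T : T^`(1)%g|) -> coset_conj.
Proof.
move=> small x y nx ny xyD; apply/negPn/negP => nxy.
have cls z w : (x^-1 * z)%g \in T^`(1)%g -> w \in z ^: T -> w \in (x *: T^`(1))%g.
  move=> xz /imsetP[t _ ->]; rewrite mem_lcoset -[(z ^ t)%g](mulKVg z) mulgA groupM //.
  by rewrite -commgEl mem_commg ?inE.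
have dis : [disjoint x ^: T & y ^: T].
  apply/pred0P => z /=; apply/negP => /andP[/class_eqP zx /class_eqP zy].
  by case/negP: nxy; apply/class_eqP; rewrite -zx zy.
have sub : x ^: T :|: y ^: T \subset (x *: T^`(1))%g.
  apply/subsetP => w; rewrite inE => /orP[]; apply: cls => //; rewrite mulVg group1; by [].
have := subset_leq_card sub; rewrite cardsU disjoint_setI0 // cards0 subn0 card_lcoset.
have := class_gt1 nx; have := class_gt1 ny => cy cx le.
case: small => [|[D4 oddi]]; first by lia.
have cx2 : #|x ^: T| = 2%N by lia.
have nC : 'C_T[x] <| T by apply: index2_normal; rewrite ?subsetIl // index_cent1.
have DC : T^`(1)%g \subset 'C_T[x].
  apply: der1_min; first exact: normal_norm.
  by apply: cyclic_abelian; apply: prime_cyclic; rewrite card_quotient ?normal_norm // index_cent1 cx2.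
move: oddi; rewrite -(Lagrange_index (subsetIl _ _) DC) oddM index_cent1 cx2; by [].
Qed.
End CosetConj.

(** * Extensions by a central sign *)

Section DoubleCover.
Variables (gT hT : finGroupType) (f : gT -> hT) (lam : gT -> int) (c : gT).
Hypotheses (fM : forall x y, f (x * y)%g = (f x * f y)%g) (f_surj : forall y, exists x, f x = y).
Hypotheses (lamM : forall x y, lam (x * y)%g = lam x * lam y).
Hypothesis lam_sign : forall x, lam x = 1 \/ lam x = -1.
Hypotheses (fc : f c = 1%g) (lamc : lam c = -1).
Hypothesis fker : forall x, f x = 1%g -> x = 1%g \/ x = c.

Lemma lam1 : lam 1%g = 1.
Proof. by have := lamM 1%g 1%g; rewrite mulg1; case: (lam_sign 1%g) => ->. Qed.

Lemma double_f1 : f 1%g = 1%g.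
Proof. by apply: (mulgI (f 1%g)); rewrite -fM !mulg1. Qed.

Lemma double_fJ x z : f (x ^ z)%g = (f x ^ f z)%g.
Proof.
have fV : f z^-1%g = (f z)^-1%g by apply: (mulgI (f z)); rewrite -fM !mulgV double_f1.
by rewrite !conjgE !fM fV.
Qed.

(** [f] and [lam] together separate elements, because the only nontrivial kernel element [c] of [f]
    has sign -1. *)
Lemma double_class x y :
  (y \in x ^: [set: gT]) = (f y \in f x ^: [set: hT]) && (lam y == lam x).
Proof.
apply/imsetP/andP => [[z _ ->]|[/imsetP[zb _ fy] /eqP ly]].
  rewrite double_fJ imset_f ?inE //; split=> //.
  by rewrite conjgE lamM lamM mulrCA -lamM mulVg lam1 mulr1.
have [z fz] := f_surj zb; rewrite -fz -double_fJ in fy; exists z => //.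
have := @fker ((x ^ z)^-1 * y)%g; rewrite fM fy -fM mulVg double_f1 => /(_ erefl)[e|e].
  by rewrite -[LHS](mulKVg (x ^ z)%g) e mulg1.
move: ly; rewrite -[y](mulKVg (x ^ z)%g) e lamM lamc conjgE lamM lamM mulrCA -lamM.
by rewrite mulVg lam1 mulr1; case: (lam_sign x) => ->.
Qed.

(** The plain and the twisted projection of [u] give the sum and, up to sign, the difference of the
    partial augmentations at [x] and [x * c]. Both are class-like after normalization, and having
    equal parity they belong to the same class. *)
Lemma class_like_double : torsion_class_like hT -> torsion_class_like gT.
Proof.
move=> clike u tu au; set d := waug lam u.
(* The twisted projection has augmentation [d]; multiplying it by this sign makes the augmentation
   1. *)
have d2 : d = 1 \/ d = -1.
  case: tu => n [n0 un]; have := waug_pow u n lam1 lamM; rewrite un.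
  have -> : waug lam (gr_one gT int) = 1 by have := waug_pow u 0 lam1 lamM.
  rewrite -/d => /esym/eqP dn.
  have : `|d| = 1 by apply/eqP; rewrite -(pexpr_eq1 n0 (normr_ge0 d)) -normrX (eqP dn) normr1.
  by lia.
have dd : d * d = 1 by case: d2 => ->.
have [||gb gbP] := clike (gr_push f (fun=> 1) u).
- by apply: gr_torsion_push => // *; rewrite mulr1.
- by rewrite augmentation_push -augmentation_waug.
pose v := gr_push f lam u.
have [||hb hbP] := clike [ffun y => d * v y].
- have [n [n0 vn]] : gr_torsion v by apply: gr_torsion_push => //; exact: lam1.
  exists (2 * n)%N; rewrite muln_gt0 n0; split=> //; rewrite gr_pow_scale.
  rewrite [gr_pow v _](_ : _ = gr_one hT int); last by rewrite mulnC gr_powM vn gr_pow_one.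
  by apply/ffunP => y; rewrite ffunE exprM expr2 dd expr1n mul1r.
- rewrite /augmentation; under eq_bigr do rewrite ffunE.
  by rewrite -mulr_sumr -/(augmentation v) augmentation_push.
(* The partial augmentation of [u] at [x * c]. *)
pose B x := \sum_(y | (f y \in f x ^: [set: hT]) && (lam y != lam x)) u y.
have sumAB x : part_aug u x + B x = (f x \in gb ^: [set: hT])%:R.
  rewrite -gbP /part_aug sum_gr_push.
  rewrite [RHS](bigID (fun y => lam y == lam x)) /=; congr (_ + _).
    by apply: eq_big => [y|y _]; rewrite ?double_class ?mulr1.
  by apply: eq_bigr => y _; rewrite mulr1.
have difAB x : d * lam x * (part_aug u x - B x) = (f x \in hb ^: [set: hT])%:R.
  rewrite -hbP /part_aug; under [RHS]eq_bigr do rewrite ffunE.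
  rewrite -mulr_sumr sum_gr_push -mulrA; congr (_ * _).
  rewrite [RHS](bigID (fun y => lam y == lam x)) /= mulrBr; congr (_ + _).
    rewrite mulr_sumr; apply: eq_big => [y|y]; rewrite ?double_class //.
    by case/andP=> _ /eqP ->; rewrite mulrC.
  rewrite /B mulr_sumr -sumrN; apply: eq_bigr => y /andP[_].
  by case: (lam_sign x) => ->; case: (lam_sign y) => ->; rewrite //= ?mulr1 ?mulrN1 ?mul1r ?mulN1r ?opprK.
have gh x : (f x \in hb ^: [set: hT]) = (f x \in gb ^: [set: hT]).
  have := sumAB x; have := difAB x.
  by case: d2 => ->; case: (lam_sign x) => ->; do 2 case: (_ \in _) => //=; lia.
(* Of the two preimages of [gb], take the one of sign [d]. *)
have [x1 fx1 lx1] : exists2 x1, f x1 = gb & lam x1 = d.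
  have [x fx] := f_surj gb; case: (eqVneq (lam x) d) => [|nx]; first by exists x.
  exists (x * c)%g; first by rewrite fM fc mulg1.
  by rewrite lamM lamc; case: d2 nx => ->; case: (lam_sign x) => ->.
exists x1 => x; rewrite double_class fx1 lx1.
have := sumAB x; have := difAB x; rewrite gh.
by case: (_ \in _); case: d2 => ->; case: (lam_sign x) => -> /=; lia.
Qed.
End DoubleCover.

(** * Finite subgroups of SL_3(Z) *)

Section Trace3.
Variables (R : comNzRingType) (A : 'M[R]_3).
Local Notation o0 := (ord0 : 'I_3).
Local Notation o1 := (lift ord0 ord0 : 'I_3).
Local Notation o2 := (lift ord0 (lift ord0 ord0) : 'I_3).

Lemma sum3E (F : 'I_3 -> R) : \sum_i F i = F o0 + F o1 + F o2.
Proof. by rewrite !big_ord_recl big_ord0 addr0 addrA. Qed.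

Lemma lift3E : [/\ lift o1 (ord0 : 'I_2) = o0, lift o1 (lift ord0 ord0 : 'I_2) = o2,
  lift o2 (ord0 : 'I_2) = o0 & lift o2 (lift ord0 ord0 : 'I_2) = o1].
Proof. by split; apply: val_inj. Qed.

Lemma det2E (B : 'M[R]_2) : \det B =
  B ord0 ord0 * B (lift ord0 ord0) (lift ord0 ord0) - B ord0 (lift ord0 ord0) * B (lift ord0 ord0) ord0.
Proof.
rewrite (expand_det_row B ord0) !big_ord_recl big_ord0 /cofactor !det_mx11 !mxE /=.
rewrite (_ : lift (lift ord0 ord0) _ = ord0); last exact: val_inj.
by rewrite /bump /=; ring.
Qed.

Lemma cofactor3E : [/\ cofactor A o0 o0 = A o1 o1 * A o2 o2 - A o1 o2 * A o2 o1,
  cofactor A o1 o1 = A o0 o0 * A o2 o2 - A o0 o2 * A o2 o0,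
  cofactor A o2 o2 = A o0 o0 * A o1 o1 - A o0 o1 * A o1 o0,
  cofactor A o0 o1 = A o1 o2 * A o2 o0 - A o1 o0 * A o2 o2 &
  cofactor A o0 o2 = A o1 o0 * A o2 o1 - A o1 o1 * A o2 o0].
Proof.
have [e1 e2 e3 e4] := lift3E.
by rewrite /cofactor !det2E !mxE ?e1 ?e2 ?e3 ?e4 /= /bump /=; split; ring.
Qed.

(** [\tr (\adj A)] is the second elementary symmetric function of the eigenvalues. *)
Lemma mxtrace_sqr3 : \tr (A *m A) = \tr A ^+ 2 - \tr (\adj A) *+ 2.
Proof.
have [c0 c1 c2 _ _] := cofactor3E.
rewrite /mxtrace !sum3E !mxE c0 c1 c2 !sum3E; ring.
Qed.

Lemma mxtrace_cube3 :
  \tr (A *m A *m A) = \tr A ^+ 3 - \tr A * \tr (\adj A) *+ 3 + \det A *+ 3.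
Proof.
have [c0 c1 c2 c01 c02] := cofactor3E.
rewrite (expand_det_row A o0) /mxtrace !sum3E !mxE c0 c1 c2 c01 c02 !sum3E !mxE !sum3E; ring.
Qed.
End Trace3.

(** * Traces, element orders and group orders in SL_3(Z) *)

Section Rotation.
Variables (gT : finGroupType) (rho : gT -> 'M[int]_3).
Hypotheses (rho_inj : injective rho) (rho1 : rho 1%g = 1%:M).
Hypotheses (rhoM : forall x y, rho (x * y)%g = rho x *m rho y).
Hypothesis rho_det : forall x, \det (rho x) = 1.
Local Notation T := [set: gT].

Definition rtr x := \tr (rho x).

Lemma rhoX x n : rho (x ^+ n)%g = rho x ^+ n.
Proof. by elim: n => [|n IH]; rewrite ?rho1 // expgS exprS rhoM IH. Qed.

Lemma rho_order x : rho x ^+ #[x] = 1.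
Proof. by rewrite -rhoX expg_order rho1. Qed.

Lemma rtr_bound x : `|rtr x| <= 3.
Proof. by have [] := finite_order_trace_int (order_gt0 x) (rho_order x). Qed.

Lemma rtr1 : rtr 1%g = 3.
Proof. by rewrite /rtr rho1 mxtrace1. Qed.

Lemma rtr_eq3 x : rtr x = 3 -> x = 1%g.
Proof.
have [_ H] := finite_order_trace_int (order_gt0 x) (rho_order x) => tx.
by apply: rho_inj; rewrite rho1; apply: H.
Qed.

Lemma rot_repr_proof (K : {group gT}) : mx_repr K (fun x => map_mx (intr : int -> algC) (rho x)).
Proof.
split=> [|x y _ _]; first by rewrite rho1 map_mx1.
by rewrite rhoM map_mxM.
Qed.

Definition rot_char (K : {group gT}) := cfRepr (MxRepresentation (rot_repr_proof K)).

Lemma rot_charE (K : {group gT}) x : x \in K -> rot_char K x = (rtr x)%:~R.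
Proof. by move=> Kx; rewrite cfunE Kx /= trace_map_mx. Qed.

(** A character value at the inverse is the complex conjugate, and integers are real. *)
Lemma rtrV x : rtr x^-1%g = rtr x.
Proof.
have := @char_inv _ T%G (rot_char T%G) x (cfRepr_char _).
by rewrite !rot_charE ?inE // rmorph_int => /intr_inj.
Qed.

Lemma rho_adj x : \adj (rho x) = rho x^-1%g.
Proof.
have := mul_mx_adj (rho x); rewrite rho_det => /(congr1 (mulmx (rho x^-1%g))).
by rewrite mulmxA -rhoM mulVg rho1 mul1mx mulmx1.
Qed.

Lemma rtr_sqr x : rtr (x ^+ 2)%g = rtr x ^+ 2 - rtr x *+ 2.
Proof. by rewrite {1}/rtr expgS expg1 rhoM mxtrace_sqr3 rho_adj -/(rtr x^-1%g) rtrV. Qed.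

Lemma rtr_cube x : rtr (x ^+ 3)%g = rtr x ^+ 3 - rtr x ^+ 2 *+ 3 + 3.
Proof.
rewrite {1}/rtr !expgS expg0 mulg1 !rhoM mulmxA mxtrace_cube3 rho_adj rho_det.
by rewrite -/(rtr x^-1%g) rtrV -/(rtr x) -expr2.
Qed.

(** The crystallographic restriction. Traces of powers are polynomials in [rtr x], and a power is
    trivial exactly when its trace is 3. *)
Lemma rtr_order x : [\/ rtr x = 3 /\ #[x] = 1%N, rtr x = -1 /\ #[x] = 2%N |
   [\/ rtr x = 0 /\ #[x] = 3%N, rtr x = 1 /\ #[x] = 4%N | rtr x = 2 /\ #[x] = 6%N]].
Proof.
have bx := rtr_bound x; have s2 := rtr_sqr x; have s3 := rtr_cube x.
have b2 := rtr_bound (x ^+ 2)%g; have s4 := rtr_sqr (x ^+ 2)%g.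
have not1 n : rtr (x ^+ n)%g != 3 -> ~~ (#[x] %| n)%N.
  by rewrite order_dvdn; apply: contraNN => /eqP ->; rewrite rtr1.
have is1 n : rtr (x ^+ n)%g = 3 -> (#[x] %| n)%N by move/rtr_eq3/eqP; rewrite -order_dvdn.
have := is1 1%N; have := not1 1%N; rewrite expg1 => n1 i1.
have s23 := rtr_cube (x ^+ 2)%g; rewrite -expgM in s23; rewrite -expgM in s4.
(* The values -2 and -3 would make the trace of [x^2] exceed 3. *)
have cases : [\/ rtr x = 3, rtr x = -1 | [\/ rtr x = 0, rtr x = 1 | rtr x = 2]].
  have : [|| rtr x == 3, rtr x == -1, rtr x == 0, rtr x == 1 | rtr x == 2].
    by move: bx s2 b2; clear; move: (rtr x) (rtr (x ^+ 2)%g) => t t2; nia.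
  by case/or4P => [/eqP ->|/eqP ->|/eqP ->|/orP[]/eqP ->]; [constructor 1|constructor 2|
    constructor 3; constructor 1|constructor 3; constructor 2|constructor 3; constructor 3].
case: cases => [t|t|[t|t|t]]; rewrite t /= in s2 s3 n1; rewrite s2 /= in s4 s23.
- by constructor 1; split=> //; apply/eqP; rewrite -dvdn1 i1.
- constructor 2; split=> //; have := is1 2%N s2; have := n1 isT.
  by move=> a /(dvdn_leq (ltn0Sn _)) b; move: a b; case: #[x] (order_gt0 x) => [|[|[]]].
- constructor 3; constructor 1; split=> //; have := is1 3%N s3; have := n1 isT.
  by move=> a c; have b := dvdn_leq (ltn0Sn _) c; move: a b c; case: #[x] (order_gt0 x) => [|[|[|[]]]].
- constructor 3; constructor 2; split=> //; have := is1 4%N s4.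
  have : ~~ (#[x] %| 2)%N by apply: not1; rewrite s2.
  by move=> a c; have b := dvdn_leq (ltn0Sn _) c; move: a b c; case: #[x] (order_gt0 x) => [|[|[|[|[]]]]].
constructor 3; constructor 3; split=> //; have := is1 6%N s23.
have : ~~ (#[x] %| 2)%N by apply: not1; rewrite s2.
have : ~~ (#[x] %| 3)%N by apply: not1; rewrite s3.
move=> a' a c; have b := dvdn_leq (ltn0Sn _) c; move: a a' b c.
by case: #[x] (order_gt0 x) => [|[|[|[|[|[|[]]]]]]].
Qed.

Definition rcnt (K : {set gT}) (i : int) := #|[set x in K | rtr x == i]|.

Lemma rcnt_sum (K : {group gT}) (F : int -> int) :
  \sum_(x in K) F (rtr x) = F 3 + F (-1) *+ rcnt K (-1) + F 0 *+ rcnt K 0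
    + F 1 *+ rcnt K 1 + F 2 *+ rcnt K 2.
Proof.
have S i : F i *+ rcnt K i = \sum_(x in K) F i * (rtr x == i)%:R.
  rewrite -mulr_sumr -natr_sum mulr_natr; congr (_ *+ _); rewrite /rcnt.
  by rewrite cardsE -sum1_card big_mkcondr /=; apply: eq_bigr => x _; case: eqP.
have n3 : rcnt K 3 = 1%N.
  rewrite /rcnt (_ : [set x in K | _] = [set 1%g]) ?cards1 //.
  apply/setP => x; rewrite !inE; apply/andP/eqP => [[_ /eqP/rtr_eq3]//|->].
  by rewrite group1 rtr1.
have -> : F 3 = F 3 *+ rcnt K 3 by rewrite n3.
rewrite !S -!big_split /=; apply: eq_bigr => x _.
by have [[-> _]|[-> _]|[[-> _]|[-> _]|[-> _]]] := rtr_order x;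
  rewrite ?mulr0 ?mulr1 ?addr0 ?add0r.
Qed.

Lemma rcnt_card (K : {group gT}) :
  #|K| = (1 + rcnt K (-1) + rcnt K 0 + rcnt K 1 + rcnt K 2)%N.
Proof.
have := rcnt_sum K (fun=> 1); rewrite sumr_const; lia.
Qed.

Lemma rtr_sum_dvd (K : {group gT}) : exists k : nat, \sum_(x in K) rtr x = #|K|%:R * k%:R.
Proof.
have /natrP[k kE] := Cnat_cfdot_char (cfRepr_char (MxRepresentation (rot_repr_proof K))) (cfun1_char K).
exists k; apply: (@intr_inj algC); rewrite rmorphM /= !natz -!pmulrn -kE cfdotE mulrA divff ?mul1r ?neq0CG //.
rewrite rmorph_sum; apply: eq_bigr => x Kx; rewrite -/(rot_char K) rot_charE // cfun1E Kx.
by rewrite rmorph1 mulr1.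
Qed.

Lemma rtr_sqr_sum_dvd (K : {group gT}) :
  exists k : nat, \sum_(x in K) rtr x ^+ 2 = #|K|%:R * k%:R.
Proof.
have chiK := cfRepr_char (MxRepresentation (rot_repr_proof K)).
have /natrP[k kE] := Cnat_cfdot_char chiK chiK.
exists k; apply: (@intr_inj algC); rewrite rmorphM /= !natz -!pmulrn -kE cfdotE mulrA divff ?mul1r ?neq0CG //.
rewrite rmorph_sum; apply: eq_bigr => x Kx; rewrite -/(rot_char K) rot_charE //.
by rewrite rmorph_int rmorphXn expr2.
Qed.

(** [k] and [m] are the inner products of the character of degree 3 with the trivial character and
    with itself. *)
Lemma rot_numerics (K : {group gT}) : exists k m : nat,
  [/\ #|K| = (1 + rcnt K (-1) + rcnt K 0 + rcnt K 1 + rcnt K 2)%N,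
      (3 + rcnt K 1 + 2 * rcnt K 2 = rcnt K (-1) + #|K| * k)%N &
      (9 + rcnt K (-1) + rcnt K 1 + 4 * rcnt K 2 = #|K| * m)%N].
Proof.
have [k kE] := rtr_sum_dvd K; have [m mE] := rtr_sqr_sum_dvd K.
exists k, m; split; first exact: rcnt_card.
  move: kE; rewrite (rcnt_sum K id) => kE; move: kE; rewrite -natrM; lia.
move: mE; rewrite (rcnt_sum K (fun z => z ^+ 2)) -natrM => mE; move: mE; lia.
Qed.

Lemma rcnt_eq0 (K : {group gT}) i n : (forall x, rtr x = i -> #[x] = n) ->
  ~~ (n %| #|K|)%N -> rcnt K i = 0%N.
Proof.
move=> iP nK; apply/eqP; rewrite cards_eq0; apply/eqP/setP => x; rewrite !inE.
apply/negP => /andP[Kx /eqP/iP nx]; case/negP: nK; by rewrite -nx order_dvdG.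
Qed.

Lemma rtr_order0 x : rtr x = 0 -> #[x] = 3%N.
Proof. by have [[-> ]|[-> ]|[[_ ->]|[-> ]|[-> ]]] := rtr_order x. Qed.
Lemma rtr_orderN1 x : rtr x = -1 -> #[x] = 2%N.
Proof. by have [[-> ]|[_ ->]|[[-> ]|[-> ]|[-> ]]] := rtr_order x. Qed.
Lemma rtr_order1 x : rtr x = 1 -> #[x] = 4%N.
Proof. by have [[-> ]|[-> ]|[[-> ]|[_ ->]|[-> ]]] := rtr_order x. Qed.
Lemma rtr_order2 x : rtr x = 2 -> #[x] = 6%N.
Proof. by have [[-> ]|[-> ]|[[-> ]|[-> ]|[_ ->]]] := rtr_order x. Qed.

(** All nontrivial elements have trace 0, so the traces add up to 3. *)
Lemma rot_3group (K : {group gT}) : 3.-group K -> (#|K| %| 3)%N.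
Proof.
move=> /p_natP[j Kj]; have no2 n : (2 %| n)%N -> ~~ (n %| #|K|)%N.
  by move=> n2; apply/negP => /(dvdn_trans n2); rewrite Kj Euclid_dvdX.
have [k [m []]] := rot_numerics K.
rewrite (rcnt_eq0 rtr_orderN1) ?no2 // (rcnt_eq0 rtr_order1) ?no2 // (rcnt_eq0 rtr_order2) ?no2 //.
by move=> _ E _; apply/dvdnP; exists k; lia.
Qed.

(** Nontrivial elements have trace 1 or -1, so the squares of the traces add up to [8 + #|K|]. *)
Lemma rot_2group (K : {group gT}) : 2.-group K -> (#|K| %| 8)%N.
Proof.
move=> /p_natP[j Kj]; have no3 n : (3 %| n)%N -> ~~ (n %| #|K|)%N.
  by move=> n2; apply/negP => /(dvdn_trans n2); rewrite Kj Euclid_dvdX.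
have [k [m []]] := rot_numerics K.
rewrite (rcnt_eq0 rtr_order0) ?no3 // (rcnt_eq0 rtr_order2) ?no3 // => cK _ E.
have : (#|K| %| 8 + #|K|)%N by apply/dvdnP; exists m; lia.
by rewrite dvdn_addl.
Qed.

Lemma rot_card_dvd24 : (#|T| %| 24)%N.
Proof.
have T0 : (0 < #|T|)%N := cardG_gt0 _.
have [P sylP] := Sylow_exists 2 T%G; have [Q sylQ] := Sylow_exists 3 T%G.
have pr23 p : prime p -> (p %| #|T|)%N -> (p == 2) || (p == 3).
  move=> p_pr /(Cauchy p_pr)[x _ xp]; move: p_pr; rewrite -xp.
  by have [[_ ->]|[_ ->]|[[_ ->]|[_ ->]|[_ ->]]] := rtr_order x.
have e3 : (#|T|`_2^' = #|T|`_3)%N.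
  apply: eq_in_partn => p; rewrite mem_primes => /and3P[p_pr _ pT].
  by rewrite !inE; case/orP: (pr23 p p_pr pT) => /eqP ->.
rewrite -(partnC 2%N T0) e3 -(card_Hall sylP) -(card_Hall sylQ) -[24%N]/(8 * 3)%N.
by rewrite dvdn_mul ?rot_2group ?rot_3group ?(pHall_pgroup sylP) ?(pHall_pgroup sylQ).
Qed.

(** * Exclusion of the quaternion group *)

Section Quaternion.
Variables (K : {group gT}) (z : gT).
Hypotheses (Kz : z \in K) (oz : #[z] = 2%N).
Hypothesis Kq : forall w, w \in K -> w \notin <[z]> -> (w * w)%g = z.

Let r x : 'M[rat]_3 := map_mx intr (rho x).
(** The standard form summed over [K]: a positive definite invariant form. *)
Let S : 'M[rat]_3 := \sum_(g in K) r g *m (r g)^T.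

Let rM x y : r (x * y)%g = r x *m r y. Proof. by rewrite /r rhoM map_mxM. Qed.
Let r1 : r 1%g = 1%:M. Proof. by rewrite /r rho1 map_mx1. Qed.

Lemma quat_form_tr : S^T = S.
Proof. by rewrite /S raddf_sum; apply: eq_bigr => g _ /=; rewrite trmx_mul trmxK. Qed.

Lemma quat_form_inv h : h \in K -> S *m (r h)^T = r h^-1%g *m S.
Proof.
move=> Kh; rewrite /S mulmx_suml mulmx_sumr (reindex_inj (mulgI h^-1%g)) /=.
apply: eq_big => [g|g _]; first by rewrite groupMl ?groupV.
by rewrite -mulmxA -trmx_mul -rM mulKVg rM mulmxA.
Qed.

Lemma quat_form_pos (v : 'rV[rat]_3) : v != 0 -> (v *m S *m v^T) 0 0 != 0.
Proof.
move=> v0; have sq (w : 'rV[rat]_3) : (w *m w^T) 0 0 = \sum_i w 0 i ^+ 2.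
  by rewrite mxE; apply: eq_bigr => i _; rewrite mxE.
have sq0 (w : 'rV[rat]_3) : 0 <= (w *m w^T) 0 0.
  by rewrite sq sumr_ge0 // => i _; rewrite sqr_ge0.
rewrite gt_eqF // /S mulmx_sumr mulmx_suml summxE (bigD1 1%g) //= ltr_pwDl //; last first.
  apply: sumr_ge0 => g _; have := sq0 (v *m r g).
  by rewrite trmx_mul !mulmxA.
rewrite r1 trmx1 !mulmx1 lt_neqAle sq0 andbT eq_sym sq psumr_neq0 => [|i _]; last exact: sqr_ge0.
have /rV0Pn[i vi] := v0; apply/hasP; exists i; first exact: mem_index_enum.
by rewrite /= lt_neqAle sqr_ge0 andbT eq_sym sqrf_eq0.
Qed.

(* Row vectors [v r(a)], for representatives [a] of [K / <z>], are orthogonal for the form [S]. *)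
Lemma quat_index : (#|rcosets <[z]> K| <= 3)%N.
Proof.
have [i vi] : exists i, row i (1%:M - r z) != 0.
  apply/existsP; rewrite -negb_forall; apply/negP => /forallP rz0.
  have /eqP : 1%:M - r z = 0 by apply/row_matrixP => i; rewrite row0; apply/eqP/rz0.
  rewrite subr_eq0 -r1 => /eqP e; have /rho_inj z1 : rho 1%g = rho z.
    by apply/matrixP => a b; move/matrixP/(_ a b): e; rewrite !mxE => /intr_inj.
  by move: oz; rewrite -z1 order1.
(* Rows of [1 - r z] are eigenvectors for -1, as [z^2 = 1]. *)
set v := row i _ in vi; have vz : v *m r z = - v.
  rewrite /v -!row_mul mulmxBl mul1mx -rM; have /eqP : (z ^+ 2 = 1)%g by rewrite -oz expg_order.
  by rewrite expgS expg1 => /eqP ->; rewrite r1 -[RHS]raddfN /= opprB.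
pose c w := v *m r w *m S *m v^T.
have c0 w : w \in K -> w \notin <[z]> -> c w = 0.
  move=> Kw nw; have ww := Kq Kw nw.
  have zw : w^-1%g = (z * w)%g.
    apply: (mulgI w); rewrite mulgV -{1}ww.
    have -> : (w * (w * w * w) = (w * w) * (w * w))%g by rewrite !mulgA.
    by rewrite ww -(expg_order z) oz expgS expg1.
  (* Transposing the 1 by 1 matrix [c w] gives [c w^-1], which is [c (z * w) = - c w]. *)
  have cw : c w = - c w.
    rewrite -{1}[c w]trmxK [(c w)^T](_ : _ = - c w); last first.
      rewrite /c !trmx_mul trmxK quat_form_tr !mulmxA -[v *m S *m _]mulmxA quat_form_inv //.
      by rewrite zw rM !mulmxA vz !mulNmx.
    by apply/matrixP => a b; rewrite !mxE [a]ord1 [b]ord1.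
  apply/matrixP => a b; move/matrixP/(_ a b): cw; rewrite !mxE => /eqP.
  by rewrite -addr_eq0 -mulr2n mulrn_eq0 => /eqP.
pose a (j : 'I_#|rcosets <[z]> K|) := repr (enum_val j).
have aP j : a j \in K /\ enum_val j = <[z]> :* a j.
  have /rcosetsP[x Kx xE] := enum_valP j; rewrite /a xE.
  have [y zy] := repr_rcosetP <[z]> x; rewrite rcosetM (rcoset_id zy); split=> //.
  by rewrite groupM // (subsetP _ _ zy) // cycle_subG.
pose V := \matrix_j (v *m r (a j)).
(* The Gram matrix is scalar; positivity makes it invertible, and its rank is at most 3. *)
have VE : V *m S *m V^T = (c 1%g 0 0)%:M.
  apply/matrixP => j k.
  have -> : (V *m S *m V^T) j k = c (a j * (a k)^-1)%g 0 0.
    have -> : (V *m S *m V^T) j k = (row j V *m S *m (row k V)^T) 0 0.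
      by rewrite -row_mul [LHS]mxE [RHS]mxE; apply: eq_bigr => l _; rewrite !mxE.
    rewrite !rowK trmx_mul /c rM !mulmxA; congr ((_ *m _) 0 0).
    by rewrite -(mulmxA _ S) quat_form_inv ?(aP k).1 // !mulmxA.
  rewrite [RHS]mxE; case: eqP => [->|jk]; first by rewrite mulgV.
  have [[Kj jE] [Kk kE]] := (aP j, aP k).
  have Kjk : (a j * (a k)^-1)%g \in K by rewrite groupM ?groupV.
  rewrite (c0 _ Kjk) ?mxE //; apply/negP => jkz; apply: jk; apply: enum_val_inj.
  by rewrite jE kE; apply/rcoset_eqP; rewrite mem_rcoset.
have c1 : ((c 1%g 0 0)%:M : 'M[rat]_#|rcosets <[z]> K|) \in unitmx.
  rewrite unitmxE det_scalar unitrX // unitfE /c r1 mulmx1; exact: quat_form_pos.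
rewrite -(mxrank_unit c1) -VE -mulmxA; apply: leq_trans (mxrankM_maxl _ _) _.
exact: rank_leq_col.
Qed.
End Quaternion.

(** The numerics leave 5 or 1 elements of trace -1. A single one, [z], would be the square of
    everything outside [<[z]>], a subgroup of index 4, against the bound 3. *)
Lemma rot_order8 (K : {group gT}) : #|K| = 8%N -> rcnt K (-1) = 5%N /\ rcnt K 1 = 2%N.
Proof.
move=> K8; have [k [m []]] := rot_numerics K.
rewrite (rcnt_eq0 rtr_order0) ?K8 // (rcnt_eq0 rtr_order2) ?K8 // => cK s1 s2.
suff a1 : rcnt K (-1) <> 1%N by move: a1 cK s1; clear; lia.
move=> /eqP/cards1P[z zK]; have := set11 z; rewrite -zK inE => /andP[Kz /eqP tz].
have oz := rtr_orderN1 tz.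
have Kq w : w \in K -> w \notin <[z]> -> (w * w)%g = z.
  move=> Kw nw; suff : (w * w)%g \in [set x in K | rtr x == -1] by rewrite zK => /set1P.
  rewrite inE groupM //= -[(w * w)%g]/(w ^+ 2)%g rtr_sqr.
  have [[_ ow]|[tw ow]|[[_ ow]|[-> _]|[_ ow]]] := rtr_order w => //.
  - by move: nw; rewrite (rtr_eq3 (x := w)) ?group1 //; move/eqP: ow; rewrite order_eq1 => /eqP ->; rewrite rtr1.
  - have : w \in [set x in K | rtr x == -1] by rewrite inE Kw tw.
    by rewrite zK => /set1P wz; rewrite wz cycle_id in nw.
  - by have := order_dvdG Kw; rewrite ow K8.
  - by have := order_dvdG Kw; rewrite ow K8.
have : (#|K : <[z]>| <= 3)%N := quat_index Kz oz Kq.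
by rewrite -divgS ?cycle_subG // -orderE oz K8.
Qed.

Lemma rot_solvable : solvable T.
Proof.
apply: Burnside_p_a_q_b; have := rot_card_dvd24; rewrite dvdn_divisors //.
by move: #|_|; apply/allP.
Qed.

(** By solvability the derived subgroup is proper. Among proper divisors of 24 only the pairs of
    orders 8, 4 and 12, 6 escape the criterion, and both are excluded. *)
Lemma rot_small_coset_conj : #|T| != 24%N -> coset_conj gT.
Proof.
move=> n24; apply: small_der_coset_conj.
have dT : (#|T| %| 24)%N := rot_card_dvd24.
have dD : (#|T^`(1)%g| %| #|T|)%N := cardSg (der_sub 1 _).
have [T1|nT1] := eqVneq T 1%g.
  have le : (#|T^`(1)%g| <= #|T|)%N := subset_leq_card (der_sub 1 _).
  by left; rewrite (leq_trans le) // T1 cards1.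
have pD : (#|T^`(1)%g| < #|T|)%N.
  by apply: proper_card; apply: (sol_der1_proper rot_solvable).
have iD : (#|T^`(1)%g| * #|T : T^`(1)%g| = #|T|)%N by apply: Lagrange; apply: der_sub.
(* A nilpotent group with cyclic abelianization is cyclic. *)
have no84 : #|T| = 8%N -> #|T^`(1)%g| <> 4%N.
  move=> T8 D4; have pT : 2.-group T by rewrite /pgroup T8.
  have /cyclic_abelian/derG1P D1 : cyclic T.
    apply: (cyclic_nilpotent_quo_der1_cyclic (pgroup_nil pT)).
    apply: prime_cyclic; rewrite card_quotient ?der_norm //.
    have i2 : #|T : T^`(1)%g| = 2%N by move: iD; rewrite D4 T8; lia.
    by rewrite [X in prime X]i2.
  by move: D4; rewrite D1 cards1.
(* The Sylow 3-subgroup of the derived subgroup is normal in the whole group with abelian quotient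
   of order 4, so it contains the derived subgroup. *)
have no126 : #|T| = 12%N -> #|T^`(1)%g| <> 6%N.
  move=> T12 D6; have [Q sylQ] := Sylow_exists 3 T^`(1)%G.
  have Q3 : #|Q| = 3%N by rewrite (card_Hall sylQ) p_part [X in logn _ X]D6.
  have sQD := pHall_sub sylQ.
  have nQ : Q <| T^`(1)%g.
    by apply: index2_normal => //; rewrite -divgS // D6 Q3.
  have QT : Q <| T.
    rewrite -(normal_Hall_pcore sylQ nQ); apply: char_normal_trans (der_normal 1 _).
    exact: pcore_char.
  have : T^`(1)%g \subset Q.
    apply: der1_min; first exact: normal_norm.
    have c4 : #|(T / Q)%g| = 4%N by rewrite card_quotient ?normal_norm // -divgS ?subsetT // T12 Q3.
    by apply: (@p2group_abelian _ 2); rewrite /pgroup c4.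
  by move/subset_leq_card; rewrite D6 Q3.
case/dvdnP: dT => q qE.
move: n24 qE pD iD no84 no126; move: #|T| #|T^`(1)%g| #|_ : _| => n d i n24 qE pD iD no84 no126.
case: (leqP d 3) => [|d4]; [by left | right].
have i2 : (1 < i)%N by case: i iD => [|[|i]] iD; lia.
have q2 : (1 < q)%N by case: q qE => [|[|q]] qE; lia.
have i3 : (i <= 3)%N by move: qE iD d4 q2; clear => qE iD d4 q2; nia.
have q3 : (q <= 3)%N by move: qE iD d4 i2; clear => qE iD d4 i2; nia.
have [i2'|i3'] : i = 2%N \/ i = 3%N by lia.
  subst i; have [q2'|q3'] : q = 2%N \/ q = 3%N by lia.
    by subst q; case: no126; lia.
  by subst q; case: no84; lia.
by subst i; have [q2'|q3'] : q = 2%N \/ q = 3%N by [lia|]; subst q; split=> //; lia.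
Qed.

(** A Sylow 2-subgroup gives lower bounds, and Frobenius's theorem makes the numbers of solutions of
    [x^3 = 1] and [x^8 = 1] divisible by 3 and 8; with the character sums this fixes all counts. *)
Lemma rot_order24 : #|T| = 24%N ->
  [/\ rcnt T (-1) = 9%N, rcnt T 0 = 8%N, rcnt T 1 = 6%N & rcnt T 2 = 0%N].
Proof.
move=> T24; have [P sylP] := Sylow_exists 2 T%G.
have P8 : #|P| = 8%N by rewrite (card_Hall sylP) p_part [X in logn _ X]T24.
have [P5 P2] := rot_order8 P8.
have le i : (rcnt P i <= rcnt T i)%N.
  by apply: subset_leq_card; apply/subsetP => x; rewrite !inE => /andP[].
have := le (-1); have := le 1; rewrite P5 P2 => le2 le5.
pose L n := #|'Ldiv_n(T)%g|.
have ld n (f : pred int) : (forall x, (#[x] %| n)%N = f (rtr x)) ->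
    (L n)%:Z = \sum_(x in T) (f (rtr x))%:R.
  move=> fP; rewrite -natr_sum natz; congr Posz; rewrite /L -sum1_card big_mkcond [RHS]big_mkcond /=.
  by apply: eq_bigr => x _; rewrite !inE -order_dvdn fP; case: (f _).
have l3 : L 3%N = (1 + rcnt T 0)%N.
  pose f t : bool := (t == 3 :> int) || (t == 0).
  have /(ld _ f) : forall x, (#[x] %| 3)%N = f (rtr x).
    by move=> x; rewrite /f; have [[-> ->]|[-> ->]|[[-> ->]|[-> ->]|[-> ->]]] := rtr_order x.
  by rewrite (rcnt_sum T%G (fun t => (f t)%:R)) /f /=; lia.
have l8 : L 8%N = (1 + rcnt T (-1) + rcnt T 1)%N.
  pose f t : bool := [|| t == 3 :> int, t == -1 | t == 1].
  have /(ld _ f) : forall x, (#[x] %| 8)%N = f (rtr x).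
    by move=> x; rewrite /f; have [[-> ->]|[-> ->]|[[-> ->]|[-> ->]|[-> ->]]] := rtr_order x.
  by rewrite (rcnt_sum T%G (fun t => (f t)%:R)) /f /=; lia.
have d3 : (3 %| L 3)%N by apply: Frobenius_Ldiv; rewrite T24.
have d8 : (8 %| L 8)%N by apply: Frobenius_Ldiv; rewrite T24.
have [k [m []]] := rot_numerics T%G; rewrite T24.
move: d3 d8; rewrite l3 l8 => /dvdnP[j jE] /dvdnP[l lE] /= cT s1 s2.
by move: le2 le5 jE lE cT s1 s2; clear; split; lia.
Qed.
End Rotation.

(** * The octahedral group *)

Section Octahedral.
Variables (gT : finGroupType) (rho : gT -> 'M[int]_3).
Hypotheses (rho_inj : injective rho) (rho1 : rho 1%g = 1%:M).
Hypotheses (rhoM : forall x y, rho (x * y)%g = rho x *m rho y).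
Hypothesis rho_det : forall x, \det (rho x) = 1.
Local Notation T := [set: gT].
Hypothesis T24 : #|T| = 24%N.

Local Notation t := (rtr rho).
Let t_order := rtr_order rho_inj rho1 rhoM rho_det.
Let t_sqr := rtr_sqr rho1 rhoM rho_det.
Let t1 := rtr1 rho1.
Let t_eq3 := rtr_eq3 rho_inj rho1 rhoM.
Let order8 := rot_order8 rho_inj rho1 rhoM rho_det.
Let order_t0 := rtr_order0 rho_inj rho1 rhoM rho_det.
Let order_tN1 := rtr_orderN1 rho_inj rho1 rhoM rho_det.
Let order_t1 := rtr_order1 rho_inj rho1 rhoM rho_det.
Let counts := rot_order24 rho_inj rho1 rhoM rho_det T24.

Lemma rtrJ x y : t (x ^ y)%g = t x.
Proof. by rewrite /rtr conjgE !rhoM mxtrace_mulC -mulmxA -rhoM mulgV rho1 mulmx1. Qed.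

Lemma oct_trace x : [\/ x = 1%g, t x = -1 | t x = 0 \/ t x = 1].
Proof.
have [[+ _]|[-> _]|[[-> _]|[-> _]|[t2 _]]] := t_order x.
- by move/t_eq3; constructor 1.
- by constructor 2.
- by constructor 3; left.
- by constructor 3; right.
have [_ _ _ /eqP] := counts; rewrite cards_eq0 => /eqP/setP/(_ x).
by rewrite !inE t2 eqxx.
Qed.

(** Otherwise [b * w] would have order 6 or 12, which does not occur here. *)
Lemma oct_cent3 b w : t b = 0 -> commute b w -> t w <> -1 /\ t w <> 1.
Proof.
move=> tb bw; have ob := order_t0 tb.
have no n : #[w] = n -> coprime 3 n -> (1 < n)%N -> False.
  move=> ow cn n1; have := orderM bw; rewrite ob ow => /(_ cn) obw.
  have [e|/order_tN1|[/order_t0|/order_t1]] := oct_trace (b * w)%g; rewrite ?obw; try lia.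
  by move: obw; rewrite e order1; lia.
by split=> [/order_tN1|/order_t1] ow; apply: (no _ ow).
Qed.

Lemma oct_cent_2group x : t x = -1 \/ t x = 1 -> (#|'C_T[x]| %| 8)%N.
Proof.
move=> tx; have : ~~ (3 %| #|'C_T[x]|)%N.
  apply/negP => /(Cauchy (isT : prime 3))[b]; rewrite inE => /andP[_ /cent1P xb] ob.
  have tb : t b = 0.
    by have [e|/order_tN1|[|/order_t1]] := oct_trace b; rewrite ?ob //; move: ob; rewrite e order1.
  by have [] := oct_cent3 tb xb; case: tx => ->.
have : (#|'C_T[x]| %| 24)%N by rewrite -T24 cardSg ?subsetIl.
rewrite [24%N](_ : _ = 3 * 8)%N // => + n3; rewrite Gauss_dvdr //.
by rewrite coprime_sym prime_coprime.
Qed.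

Lemma oct_sylow (C : {group gT}) : #|C| = 8%N -> 2.-Sylow(T) C.
Proof.
by move=> C8; rewrite pHallE subsetT C8 p_part [X in logn _ X]T24.
Qed.

(** There are 9 involutions but only 5 in a Sylow 2-subgroup [P], so [P] is not normal. Two
    conjugates of [P] meet in order 4, and the meet is normal in both, so its normalizer is
    everything. *)
Lemma oct_klein : exists K : {group gT},
  [/\ K <| T, #|K| = 4%N & exists2 P : {group gT}, #|P| = 8%N & K \subset P].
Proof.
have [P sylP] := Sylow_exists 2 T%G.
have P8 : #|P| = 8%N by rewrite (card_Hall sylP) p_part [X in logn _ X]T24.
have [x nx] : exists x, (P :^ x)%g != P.
  apply/existsP; rewrite -negb_forall; apply/negP => /forallP nP.
  have nPT : P <| T by rewrite /normal subsetT; apply/subsetP => x _; rewrite inE (eqP (nP x)).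
  have : (rcnt rho T (-1) <= rcnt rho P (-1))%N.
    apply/subset_leq_card/subsetP => y; rewrite !inE /= => /eqP ty; rewrite ty eqxx andbT.
    by rewrite (mem_normal_Hall sylP nPT) ?inE // /p_elt (order_tN1 ty).
  by have [-> _ _ _] := counts; have [-> _] := order8 P8.
pose K := (P :&: P :^ x)%G.
have Px8 : #|(P :^ x)%g| = 8%N by rewrite cardJg.
have ltK : (#|K| < 8)%N.
  rewrite ltn_neqAle -{2}P8 subset_leq_card ?subsetIl // andbT; apply/eqP => K8.
  case/eqP: nx; apply/eqP; rewrite eq_sym eqEcard Px8 P8 leqnn andbT.
  by apply/setIidPl/eqP; rewrite eqEcard subsetIl P8 -K8 /=.
have K4 : #|K| = 4%N.
  have E : (#|P| * #|(P :^ x)%g| = #|(P * P :^ x)%g| * #|K|)%N := mul_cardG P (P :^ x)%G.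
  rewrite P8 Px8 in E; have le24 : (#|(P * P :^ x)%g| <= 24)%N by rewrite -T24 subset_leq_card ?subsetT.
  have : (#|K| %| 8)%N by rewrite -P8 cardSg ?subsetIl.
  (* The product set has [64 / #|K|] elements, at most 24. *)
  have gt2 : (2 < #|K|)%N by move: E le24; clear; nia.
  by move: gt2 ltK; case: #|K| => [|[|[|[|[|[|[|[|]]]]]]]].
exists K; split=> //; last by exists P; rewrite ?subsetIl.
have nKP : P \subset 'N(K).
  by apply/normal_norm/index2_normal; rewrite ?subsetIl // -divgS ?subsetIl // K4 P8.
have nKPx : (P :^ x)%g \subset 'N(K).
  by apply/normal_norm/index2_normal; rewrite ?subsetIr // -divgS ?subsetIr // K4 Px8.
have ltN : (8 < #|'N(K)|)%N.
  rewrite -P8 proper_card // properE nKP /=; apply/negP => NP.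
  case/eqP: nx; apply/eqP; rewrite eqEcard Px8 P8 leqnn andbT.
  exact: subset_trans nKPx NP.
have d8 : (8 %| #|'N(K)|)%N by rewrite -P8 cardSg.
have d24 : (#|'N(K)| %| 24)%N by rewrite -T24 cardSg ?subsetT.
have N24 : #|'N(K)| = 24%N.
  have := dvdn_leq (ltn0Sn _) d24; case/dvdnP: d8 ltN d24 => -[|[|[|[|q]]]] -> //; lia.
by rewrite /normal subsetT /= (_ : 'N(K) = T) // ; apply/eqP; rewrite eqEcard subsetT N24 T24.
Qed.

Section Klein.
Variables (K P : {group gT}).
Hypotheses (nKT : K <| T) (K4 : #|K| = 4%N) (P8 : #|P| = 8%N) (sKP : K \subset P).

Lemma klein_conj x y : (x ^ y \in K)%g = (x \in K).
Proof. by rewrite memJ_norm // (subsetP (normal_norm nKT)) ?inE. Qed.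

Lemma klein_sharp : #|(K :\ 1)%g| = 3%N.
Proof. by have := cardsD1 1%g K; rewrite group1 K4 add1n => /succn_inj/esym. Qed.

Lemma klein_not3 x : x \in K -> t x <> 0.
Proof. by move=> Kx /order_t0 ox; have := order_dvdG Kx; rewrite ox K4. Qed.

(** The centralizer of [b] has odd order, so 8 divides the class size, and only 8 elements have
    trace 0. *)
Lemma oct_class0 b : t b = 0 -> b ^: T = [set x | t x == 0].
Proof.
move=> tb; have [_ b8 _ _] := counts; apply/eqP; rewrite eqEcard; apply/andP; split.
  by apply/subsetP => _ /imsetP[y _ ->]; rewrite inE rtrJ tb.
rewrite (_ : #|_| = 8%N); last by rewrite -b8; apply: eq_card => x; rewrite !inE.
have d24 : (#|'C_T[b]| %| 24)%N by rewrite -T24 cardSg ?subsetIl.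
have : ~~ (2 %| #|'C_T[b]|)%N.
  apply/negP => /(Cauchy (isT : prime 2))[w]; rewrite inE => /andP[_ /cent1P wb] ow.
  have [n1 n2] := oct_cent3 tb (commute_sym wb).
  have [e|//|[/order_t0|//]] := oct_trace w; last by rewrite ow.
  by move: ow; rewrite e order1.
have iE : (#|'C_T[b]| * #|b ^: T| = 24)%N by rewrite -index_cent1 Lagrange ?subsetIl.
move: d24 iE; rewrite [24%N](_ : _ = 8 * 3)%N // => d24 iE n2.
have : (8 %| #|'C_T[b]| * #|b ^: T|)%N by rewrite iE dvdn_mulr.
rewrite Gauss_dvdr => [/dvdn_leq -> //|]; last first.
  by rewrite -[8%N]/(2 ^ 3)%N coprime_pexpl // prime_coprime.
by rewrite card_gt0; apply/set0Pn; exists b; exact: class_refl.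
Qed.

Lemma oct_exists i : (i == -1) || (i == 0) || (i == 1) -> exists x, t x = i.
Proof.
have [c2 c0 c1 _] := counts.
have ex j : (0 < rcnt rho T j)%N -> exists x, t x = j.
  by case/card_gt0P=> x; rewrite !inE => /eqP; exists x.
by case/orP=> [/orP[]|] /eqP ->; apply: ex; rewrite ?c2 ?c0 ?c1.
Qed.

(** An element [b] of order 3 does not commute with [w], so conjugation by its powers yields three
    distinct elements. *)
Lemma oct_classK w : w \in K -> w != 1%g -> w ^: T = (K :\ 1%g)%g.
Proof.
move=> Kw nw; have [b tb] := @oct_exists 0 isT.
have tbb : t (b ^+ 2)%g = 0 by rewrite t_sqr tb.
have ncom c : t c = 0 -> (w ^ c != w)%g.
  move=> tc; apply/negP => /eqP/conjg_fixP/commgP/commute_sym/(oct_cent3 tc)[n1 n2].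
  by have [e|//|[/(klein_not3 Kw)//|//]] := oct_trace w; rewrite e eqxx in nw.
have K3 := klein_sharp.
apply/eqP; rewrite eqEcard; apply/andP; split.
  apply/subsetP => _ /imsetP[y _ ->]; rewrite !inE klein_conj Kw andbT.
  by rewrite -(conj1g y) (inj_eq (@conjg_inj _ y)).
have : (#|[set w; w ^ b; w ^ (b ^+ 2)]%g| <= #|w ^: T|)%N.
  apply/subset_leq_card/subsetP => y; rewrite !inE => /orP[/orP[]|] /eqP ->.
  - exact: class_refl.
  - by rewrite imset_f ?inE.
  - by rewrite imset_f ?inE.
rewrite K3; apply: leq_trans; rewrite -setUA cardsU1 cards2 !inE !(eq_sym w).
rewrite (negPf (ncom _ tb)) (negPf (ncom _ tbb)) /=.
by rewrite expgS expg1 conjgM eq_sym (inj_eq (@conjg_inj _ b)) ncom.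
Qed.

Lemma klein_trace w : w \in K -> w != 1%g -> t w = -1.
Proof.
move=> Kw nw; have d2 : (2 %| #|K|)%N by rewrite K4.
have [z Kz oz] := Cauchy (isT : prime 2) d2.
have nz : z != 1%g by rewrite -order_eq1 oz.
have : w \in z ^: T by rewrite oct_classK // !inE nw Kw.
case/imsetP=> y _ ->; rewrite rtrJ.
have [e|//|[/order_t0|/order_t1]] := oct_trace z; rewrite ?oz //.
by rewrite e eqxx in nz.
Qed.

Lemma klein_cnt : #|[set x | (t x == -1) && (x \notin K)]| = 6%N.
Proof.
have [c2 _ _ _] := counts.
have K3 := klein_sharp.
have : #|[set x in T | t x == -1]| = 9%N := c2.
rewrite -(cardsID K) (_ : [set x in T | _] :&: K = (K :\ 1)%g) => [|]; last first.
  apply/setP => x; rewrite !inE /= andbC; case: (boolP (x \in K)) => Kx; rewrite ?andbF //=.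
  by case: (eqVneq x 1%g) => [->|nx]; rewrite ?t1 ?klein_trace.
rewrite K3 => -[E]; rewrite -E; apply: eq_card => x; rewrite !inE /= andbC; by [].
Qed.

(** The class has 6 elements once the centralizer is not of order 8. A centralizer of order 8 has
    exactly two elements of trace 1, but it would contain [f], [f^-1] and [f * s] for an involution
    [s] other than [f^2]. *)
Lemma oct_class1 f : t f = 1 -> f ^: T = [set x | t x == 1].
Proof.
move=> tf; have of_ := order_t1 tf; have [_ _ f6 _] := counts.
apply/eqP; rewrite eqEcard; apply/andP; split.
  by apply/subsetP => _ /imsetP[y _ ->]; rewrite inE rtrJ tf.
rewrite (_ : #|_| = 6%N); last by rewrite -f6; apply: eq_card => x; rewrite !inE.
have iE : (#|'C_T[f]| * #|f ^: T| = 24)%N by rewrite -index_cent1 Lagrange ?subsetIl.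
have d8 := oct_cent_2group (or_intror tf).
suff C8 : #|'C_T[f]| <> 8%N.
  have C4 : (#|'C_T[f]| <= 4)%N.
    have := dvdn_leq (ltn0Sn _) d8; move: d8 C8; clear.
    by move: #|_| => n; do 9 (case: n => [|n] //).
  by move: iE C4; clear; nia.
move=> C8; have [n5 n2] := order8 C8.
have Cf : f \in 'C_T[f] by rewrite inE in_setT cent1id.
have f2 : t (f ^+ 2)%g = -1 by rewrite t_sqr tf.
have [s Cs /andP[ts nsf]] : exists2 s, s \in 'C_T[f] & (t s == -1) && (s != f ^+ 2)%g.
  set A := [set x in 'C_T[f] | t x == -1]; have A5 : #|A| = 5%N := n5.
  have Af : (f ^+ 2)%g \in A by rewrite inE groupX // f2 eqxx.
  have := cardsD1 (f ^+ 2)%g A; rewrite A5 Af add1n => /succn_inj e.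
  have /card_gt0P[s] : (0 < #|A :\ (f ^+ 2)%g|)%N by rewrite -e.
  by rewrite 3!inE => /and3P[ns Cs ts]; exists s; rewrite ?ts.
have sf : commute f s by move: Cs; rewrite inE => /andP[_ /cent1P].
have s1 : s != 1%g by apply: contraTneq ts => ->; rewrite t1.
have tfs : t (f * s)%g = 1.
  have e2 : ((f * s) ^+ 2 = f ^+ 2)%g.
    rewrite expgMn // (_ : (s ^+ 2 = 1)%g) ?mulg1 //.
    by rewrite -(order_tN1 (eqP ts)) expg_order.
  have := t_sqr (f * s)%g; rewrite e2 f2.
  by have [->|->|[->|->]] := oct_trace (f * s)%g; rewrite ?t1.
have : (#|[set f; f^-1; (f * s)]%g| <= 2)%N.
  rewrite -[X in (_ <= X)%N]n2; apply/subset_leq_card/subsetP => y /setUP[/setUP[]|] /set1P ->.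
  - by rewrite inE Cf tf.
  - by rewrite inE groupV Cf (rtrV rho1 rhoM) tf.
  - by rewrite inE groupM // tfs.
have nf : f != f^-1%g.
  apply: contra_eq_neq f2 => e; rewrite expgS expg1 {2}e mulgV t1; by [].
have nfs : f != (f * s)%g by rewrite eq_sym -{2}[f]mulg1 (inj_eq (mulgI f)).
have nVfs : f^-1%g != (f * s)%g.
  apply: contra_neq nsf => e; apply: (mulgI f); rewrite -e; apply/eqP.
  by rewrite eq_invg_mul -!expgS -of_ expg_order.
by rewrite -setUA cardsU1 cards2 !inE nVfs negb_or nf nfs.
Qed.

(** A centralizer of order 8 would be a Sylow subgroup, hence the union of [K] and [K :* s]. All its
    squares would be trivial, but it must contain an element of order 4. *)
Lemma oct_classS s : t s = -1 -> s \notin K -> s ^: T = [set x | (t x == -1) && (x \notin K)].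
Proof.
move=> ts nKs; apply/eqP; rewrite eqEcard; apply/andP; split.
  by apply/subsetP => _ /imsetP[y _ ->]; rewrite inE rtrJ ts klein_conj nKs.
rewrite klein_cnt.
have iE : (#|'C_T[s]| * #|s ^: T| = 24)%N by rewrite -index_cent1 Lagrange ?subsetIl.
have d8 := oct_cent_2group (or_introl ts).
suff C8 : #|'C_T[s]| <> 8%N.
  have C4 : (#|'C_T[s]| <= 4)%N.
    have := dvdn_leq (ltn0Sn _) d8; move: d8 C8; clear.
    by move: #|_| => n; do 9 (case: n => [|n] //).
  by move: iE C4; clear; nia.
move=> C8; have [_ n2] := order8 C8.
have sKC : K \subset 'C_T[s].
  apply: subset_trans (pcore_sub_Hall (oct_sylow C8)).
  by apply: pcore_max => //; rewrite /pgroup K4.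
have Cs : s \in 'C_T[s] by rewrite inE in_setT cent1id.
have sq1 x : t x = -1 -> (x ^+ 2 = 1)%g by move/order_tN1 <-; rewrite expg_order.
have Ksq x : x \in K -> (x ^+ 2 = 1)%g.
  by move=> Kx; case: (eqVneq x 1%g) => [->|nx]; rewrite ?expg1n // sq1 // klein_trace.
have /card_gt0P[y] : (0 < rcnt rho 'C_T[s] 1)%N by rewrite [X in (_ < X)%N]n2.
rewrite inE => /andP[Cy /eqP ty].
have y2 : (y ^+ 2 != 1)%g by rewrite -order_dvdn (order_t1 ty).
case: (boolP (y \in K)) => Ky; first by rewrite Ksq ?eqxx in y2.
have : y \in 'C_T[s] :\: K by rewrite inE Ky.
rewrite -(@rcoset_index2 _ 'C_T[s]%G K s) //; last first.
  - by rewrite inE nKs.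
  - by rewrite -divgS // K4 C8.
case/rcosetP=> k Kk yE; case/negP: y2; rewrite yE expgMn; last first.
  by have := subsetP sKC _ Kk; rewrite inE => /andP[_ /cent1P].
by rewrite Ksq // sq1 // mulg1.
Qed.

(** Supplies two elements of different trace with a common coset sum, on which the exclusion of the
    spurious unit rests. *)
Lemma oct_coset : exists s f, [/\ t s = -1, t f = 1, s \notin K & (K :* s = K :* f)%g].
Proof.
have [n5 n2] := order8 P8.
have /card_gt0P[f] : (0 < rcnt rho P 1)%N by rewrite n2.
rewrite inE => /andP[Pf /eqP tf].
have [s Ps /andP[/eqP ts nKs]] : exists2 s, s \in P & (t s == -1) && (s \notin K).
  have : ~~ ([set x in P | t x == -1] \subset (K :\ 1)%g).
    by apply: contraPN n5 => /subset_leq_card; rewrite klein_sharp /rcnt => le e; rewrite e in le.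
  case/subsetPn=> s; rewrite inE => /andP[Ps ts]; rewrite !inE negb_and negbK => /orP[/eqP e|nKs].
    by move: ts; rewrite e t1.
  by exists s; rewrite ?ts.
have nKf : f \notin K.
  apply/negP => Kf; case: (eqVneq f 1%g) => [e|nf]; first by move: tf; rewrite e t1.
  by move: tf; rewrite klein_trace.
have i2 : #|P : K| = 2%N by rewrite -divgS // K4 P8.
by exists s, f; split; rewrite ?(rcoset_index2 sKP i2) // inE ?nKs ?nKf.
Qed.

(** [E] is generated by [K] and an element of order 3; its 12 elements are the 4 of [K] and the 8 of
    trace 0. *)
Lemma oct_even : exists E : {group gT}, [/\ E <| T, #|T : E| = 2%N &
  forall x, (x \in E) = (x \in K) || (t x == 0)].
Proof.
have [b tb] := @oct_exists 0 isT; have ob := order_t0 tb.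
have nKb : <[b]>%g \subset 'N(K) by apply: subset_trans (normal_norm nKT); exact: subsetT.
pose E := (K <*> <[b]>)%G.
have E12 : #|E| = 12%N.
  rewrite /= norm_joinEr // TI_cardMg ?K4 -?orderE ?ob //.
  by apply: coprime_TIg; rewrite K4 -orderE ob.
have i2 : #|T : E| = 2%N by rewrite -divgS ?subsetT // E12 T24.
have nE : E <| T by apply: index2_normal; rewrite ?subsetT.
exists E; split=> // x; apply/esym; have [_ c0 _ _] := counts.
suff /setP/(_ x) : K :|: [set x | t x == 0] = E by rewrite !inE.
apply/eqP; rewrite eqEcard; apply/andP; split.
  rewrite subUset joing_subl /= -(oct_class0 tb); apply/subsetP => _ /imsetP[y _ ->].
  rewrite memJ_norm ?(subsetP (normal_norm nE)) ?inE //.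
  by rewrite (subsetP (joing_subr _ _)) ?cycle_id.
rewrite E12 cardsU K4 (_ : #|[set x | t x == 0]| = 8%N); last by rewrite -c0; apply: eq_card => y; rewrite !inE.
rewrite (_ : _ :&: _ = set0) ?cards0 //; apply/setP => y; rewrite !inE.
by apply/negP => /andP[/klein_not3 ny /eqP].
Qed.
End Klein.
End Octahedral.

(** * Torsion units of the octahedral group *)

Lemma mxtrace_gr_lin (gT : finGroupType) n (r : gT -> 'M[int]_n) (u : {ffun gT -> int}) :
  \tr (gr_lin r u) = \sum_x u x * \tr (r x).
Proof. by rewrite /gr_lin raddf_sum; apply: eq_bigr => x _; rewrite /= mxtraceZ. Qed.

Lemma torsion_trace (gT : finGroupType) n (r : gT -> 'M[int]_n) (u : {ffun gT -> int}) :
    r 1%g = 1%:M -> (forall x y, r (x * y)%g = r x *m r y) -> gr_torsion u ->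
  `|\sum_x u x * \tr (r x)| <= n%:R /\
  (forall e, `|e| = 1 -> \sum_x u x * \tr (r x) = e *+ n -> gr_lin r u = e%:M).
Proof.
move=> r1 rM [m [m0 um]]; rewrite -mxtrace_gr_lin; apply: (finite_order_trace_int m0).
by rewrite -gr_lin_pow // um gr_lin_of r1.
Qed.

Lemma order6_class_like (hT : finGroupType) : #|[set: hT]| = 6%N -> torsion_class_like hT.
Proof.
move=> h6; apply/coset_conj_class_like/small_der_coset_conj; left.
have sol : solvable [set: hT] by apply: Burnside_p_a_q_b; rewrite [X in primes X]h6.
have nh1 : [set: hT] != 1%g by apply: contra_eq_neq h6 => ->; rewrite cards1.
have lt : (#|[set: hT]^`(1)%g| < #|[set: hT]|)%N.
  by apply: proper_card; apply: (sol_der1_proper sol).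
have d : (#|[set: hT]^`(1)%g| %| #|[set: hT]|)%N := cardSg (der_sub 1 _).
by move: lt d; rewrite h6; move: #|_| => n; do 7 (case: n => [|n] //).
Qed.

Section OctahedralUnits.
Variables (gT : finGroupType) (rho : gT -> 'M[int]_3).
Hypotheses (rho_inj : injective rho) (rho1 : rho 1%g = 1%:M).
Hypotheses (rhoM : forall x y, rho (x * y)%g = rho x *m rho y).
Hypothesis rho_det : forall x, \det (rho x) = 1.
Local Notation T := [set: gT].
Hypothesis T24 : #|T| = 24%N.

Local Notation t := (rtr rho).
Let t_sqr := rtr_sqr rho1 rhoM rho_det.
Let t1 := rtr1 rho1.
Let o_trace := oct_trace rho_inj rho1 rhoM rho_det T24.

Variables (K E : {group gT}).
Hypotheses (nKT : K <| T) (K4 : #|K| = 4%N).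
Hypotheses (nET : E <| T) (iE : #|T : E| = 2%N).
Hypothesis EP : forall x, (x \in E) = (x \in K) || (t x == 0).

Let K_trace := klein_trace rho_inj rho1 rhoM rho_det T24 nKT K4.
Let K_not3 := klein_not3 rho_inj rho1 rhoM rho_det K4.

Implicit Type u : {ffun gT -> int}.
(** These four sums are the partial augmentations at the nontrivial classes: involutions of [K],
    order 3, other involutions, order 4. *)
Let SA u := \sum_(x | (x \in K) && (x != 1%g)) u x.
Let SB u := \sum_(x | t x == 0) u x.
Let SS u := \sum_(x | (t x == -1) && (x \notin K)) u x.
Let SF u := \sum_(x | t x == 1) u x.

Variant oct_spec x : bool -> bool -> bool -> bool -> bool -> bool -> Prop :=
| OctOne of x = 1%g : oct_spec x true true false false false true
| OctK of x \in K & x != 1%g & t x = -1 : oct_spec x false true false true false true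
| OctB of x \notin K & t x = 0 : oct_spec x false false true false false true
| OctS of x \notin K & t x = -1 : oct_spec x false false false true false false
| OctF of x \notin K & t x = 1 : oct_spec x false false false false true false.

Lemma octP x : oct_spec x (x == 1%g) (x \in K) (t x == 0) (t x == -1) (t x == 1) (x \in E).
Proof.
rewrite EP; case: eqVneq => [->|n1]; first by rewrite group1 t1; constructor.
case: (boolP (x \in K)) => Kx; first by rewrite K_trace //; constructor; rewrite ?K_trace.
have [e|e|[e|e]] := o_trace x; rewrite ?e /=; try by constructor.
by rewrite e eqxx in n1.
Qed.

Lemma sum_oct u (F : gT -> int) c1 cA cB cS cF : F 1%g = c1 ->
    (forall x, x \in K -> x != 1%g -> F x = cA) -> (forall x, t x = 0 -> F x = cB) ->
    (forall x, t x = -1 -> x \notin K -> F x = cS) -> (forall x, t x = 1 -> F x = cF) ->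
  \sum_x u x * F x = u 1%g * c1 + SA u * cA + SB u * cB + SS u * cS + SF u * cF.
Proof.
move=> F1 FA FB FS FF.
have -> : u 1%g = \sum_(x | x == 1%g) u x by rewrite big_pred1_eq.
rewrite /SA /SB /SS /SF !mulr_suml.
rewrite [X in _ = X + _ + _ + _ + _]big_mkcond [X in _ = _ + X + _ + _ + _]big_mkcond.
rewrite [X in _ = _ + X + _ + _]big_mkcond [X in _ = _ + X + _]big_mkcond.
rewrite [X in _ = _ + X]big_mkcond -!big_split /=; apply: eq_bigr => x _.
case: octP => [->|Kx nx _|_ tx|nx tx|_ tx] /=; rewrite ?addr0 ?add0r.
- by rewrite F1.
- by rewrite (FA x).
- by rewrite (FB x).
- by rewrite (FS x).
- by rewrite (FF x).
Qed.

Lemma sum_octP u (Q : pred gT) (q1 qA qB qS qF : bool) : Q 1%g = q1 ->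
    (forall x, x \in K -> x != 1%g -> Q x = qA) -> (forall x, t x = 0 -> Q x = qB) ->
    (forall x, t x = -1 -> x \notin K -> Q x = qS) -> (forall x, t x = 1 -> Q x = qF) ->
  \sum_(x | Q x) u x = u 1%g * q1%:R + SA u * qA%:R + SB u * qB%:R + SS u * qS%:R + SF u * qF%:R.
Proof.
move=> Q1 QA QB QS QF; rewrite -(@sum_oct u (fun x => (Q x)%:R)).
- by rewrite big_mkcond; apply: eq_bigr => x _; case: (Q x); rewrite ?mulr1 ?mulr0.
- by rewrite Q1.
- by move=> x Kx nx; rewrite (QA x).
- by move=> x tx; rewrite (QB x).
- by move=> x tx nx; rewrite (QS x).
- by move=> x tx; rewrite (QF x).
Qed.

Definition oct_sgn x : int := if x \in E then 1 else -1.

Lemma oct_sgnM x y : oct_sgn (x * y)%g = oct_sgn x * oct_sgn y.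
Proof.
rewrite /oct_sgn; case: (boolP (x \in E)) => Ex; first by rewrite groupMl // mul1r.
case: (boolP (y \in E)) => Ey; first by rewrite groupMr // (negPf Ex).
have : x \in (E :* y^-1)%g.
  by rewrite (@rcoset_index2 _ [set: gT]%G) ?subsetT // !inE ?groupV ?Ex ?Ey.
by rewrite mem_rcoset invgK => ->.
Qed.

(** The second representation of degree 3, twisted by the sign character with kernel [E]. *)
Definition oct_rho' x := oct_sgn x *: rho x.

Lemma oct_rho'1 : oct_rho' 1%g = 1%:M.
Proof. by rewrite /oct_rho' /oct_sgn group1 scale1r rho1. Qed.

Lemma oct_rho'M x y : oct_rho' (x * y)%g = oct_rho' x *m oct_rho' y.
Proof.
by rewrite /oct_rho' oct_sgnM rhoM -scalemxAl -scalemxAr scalerA.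
Qed.

Lemma sum_trace u : \sum_x u x * t x = u 1%g * 3 - SA u - SS u + SF u.
Proof.
by rewrite (@sum_oct u t 3 (-1) 0 (-1) 1) //; ring.
Qed.

Lemma sum_trace' u : \sum_x u x * \tr (oct_rho' x) = u 1%g * 3 - SA u + SS u - SF u.
Proof.
have tE x : \tr (oct_rho' x) = (if x \in E then t x else - t x).
  by rewrite mxtraceZ /oct_sgn; case: ifP; rewrite ?mul1r ?mulN1r.
rewrite (@sum_oct u _ 3 (-1) 0 1 (-1)); first by ring.
- by rewrite tE group1 t1.
- by move=> x Kx nx; rewrite tE EP Kx K_trace.
- by move=> x tx; rewrite tE tx oppr0 if_same.
- by move=> x tx nx; rewrite tE EP (negPf nx) tx.
- by move=> x tx; rewrite tE; case: octP => [e|_ _ e|_ e|_ e|_ ->] //; move: tx; rewrite e ?t1.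
Qed.

(** The quotient by [K] has order 6, so the image of [u] and its powers follow one element [g]; the
    sums over [K] and [E] test membership in 1 and [E / K] there. *)
Lemma oct_quotient u : gr_torsion u -> augmentation u = 1 -> exists g, forall k,
  gr_pow u k 1%g + SA (gr_pow u k) = (g ^+ k \in K)%g%:R /\
  gr_pow u k 1%g + SA (gr_pow u k) + SB (gr_pow u k) = (g ^+ k \in E)%g%:R.
Proof.
move=> tu au; have nK := normal_norm nKT; have fM := quo_mul nK.
have h6 : #|[set: coset_of K]| = 6%N.
  by rewrite coset_of_setT // card_quotient // -divgS ?subsetT // K4 [X in (X %/ _)%N]T24.
have clike := order6_class_like h6; pose f := gr_push (coset K) (fun=> 1 : int).
have tfu : gr_torsion (f u) by apply: gr_torsion_push => // *; rewrite mulr1.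
have afu : augmentation (f u) = 1 by rewrite augmentation_push -augmentation_waug.
have [gb gbP] := clike _ tfu afu; have [g _ gE] := cosetP gb; exists g => k.
have := class_like_exp clike k tfu afu gbP.
rewrite -gr_push_pow //.
have gkE : (gb ^+ k = coset K (g ^+ k))%g by rewrite gE morphX // (subsetP nK) ?inE.
rewrite gkE; set v := gr_pow u k => vg.
have nb x : x \in 'N(K) by rewrite (subsetP nK) ?inE.
have inK x : (coset K x == 1%g) = (x \in K).
  by apply/eqP/idP => [|Kx]; [exact: coset_idr | exact: coset_id].
have inE_ x : (coset K x \in (E / K)%g) = (x \in E).
  apply/idP/idP => [|Ex]; last by rewrite mem_quotient.
  case/morphimP=> y _ Ey /eqP; rewrite eq_sym quo_eq // => yx.
  by rewrite -(mulKVg y x) groupM // EP yx.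
split.
  have := sum_class_like vg (Q := fun y => y == 1%g).
  rewrite inK sum_gr_push => <- => [|x y]; last first.
    by rewrite -{1}(conj1g y) (inj_eq (@conjg_inj _ y)).
  under eq_bigr do rewrite mulr1; under eq_bigl do rewrite inK.
  rewrite (@sum_octP v (fun x => x \in K) true true false false false) ?mulr1 ?mulr0 ?addr0 ?group1 //.
  - by move=> x tx; apply/negP => /K_not3.
  - by move=> x tx /negPf.
  - by move=> x tx; case: octP => // [e|_ _ e]; move: tx; rewrite e ?t1.
have := sum_class_like vg (Q := fun y => y \in (E / K)%g).
rewrite inE_ sum_gr_push => <- => [|x y]; last first.
  have nEK : (E / K)%g <| [set: coset_of K] by rewrite coset_of_setT // quotient_normal.
  by rewrite memJ_norm // (subsetP (normal_norm nEK)) ?inE.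
under eq_bigr do rewrite mulr1; under eq_bigl do rewrite inE_.
rewrite (@sum_octP v (fun x => x \in E) true true true false false) ?mulr1 ?mulr0 ?addr0 ?group1 //.
- by move=> x Kx _; rewrite EP Kx.
- by move=> x tx; rewrite EP tx orbT.
- by move=> x tx nx; rewrite EP tx (negPf nx).
- by move=> x tx; rewrite EP tx orbF; case: octP => // [e|_ _ e]; move: tx; rewrite e ?t1.
Qed.

Lemma sum_classes u : augmentation u = u 1%g + SA u + SB u + SS u + SF u.
Proof.
rewrite /augmentation -[LHS](_ : \sum_(x | predT x) u x = _) //.
by rewrite (@sum_octP u predT true true true true true) // !mulr1.
Qed.

(* Elements with square in K^# are exactly those of order 4. *)
Lemma oct_sqr_congr u : (2 %| SA (gr_pow u 2) - SF u)%Z.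
Proof.
have [w Kw nw] : exists2 w, w \in K & w != 1%g.
  have := klein_sharp K4; case: (set_0Vmem (K :\ 1)%g) => [-> |[w]]; first by rewrite cards0.
  by rewrite !inE => /andP[nw Kw] _; exists w.
have wK := oct_classK rho_inj rho1 rhoM rho_det T24 nKT K4 Kw nw.
have := part_aug_congr u w (isT : prime 2); rewrite /part_aug wK.
congr (_ %| _ - _)%Z.
  by rewrite /SA; apply: eq_bigl => x; rewrite !inE andbC.
rewrite /SF; apply: eq_bigl => x; rewrite !inE.
case: (boolP (t x == 1)) => [/eqP tx|ntx].
  have tx2 : t (x ^+ 2)%g = -1 by rewrite t_sqr tx.
  have x2 : (x ^+ 2 != 1)%g by apply: contra_eq_neq tx2 => ->; rewrite t1.
  have : (x ^+ 2 \in E)%g.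
    have := oct_sgnM x x; rewrite -[(x * x)%g]/(x ^+ 2)%g /oct_sgn.
    by case: (x \in E); case: (x ^+ 2 \in E)%g.
  by rewrite EP tx2 orbF x2.
apply/negP => /andP[x2 Kx2]; have := K_trace Kx2 x2; rewrite t_sqr.
by move: ntx; have [->|->|[->|->]] := o_trace x; rewrite ?t1.
Qed.
Lemma oct_clikeP u x0 : u 1%g = (x0 == 1%g)%:R ->
    SA u = ((x0 \in K) && (x0 != 1%g))%:R -> SB u = (t x0 == 0)%:R ->
    SS u = ((t x0 == -1) && (x0 \notin K))%:R -> SF u = (t x0 == 1)%:R ->
  class_like u x0.
Proof.
move=> H1 HA HB HS HF x; rewrite /part_aug class_sym.
case: (octP x) => [->|Kx nx _|_ tx|nx tx|_ tx].
- by rewrite class1G big_set1 inE.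
- rewrite (oct_classK rho_inj rho1 rhoM rho_det T24 nKT K4) // !inE andbC -HA.
  by apply: eq_bigl => y; rewrite !inE andbC.
- rewrite (oct_class0 rho_inj rho1 rhoM rho_det T24) // inE -HB.
  by apply: eq_bigl => y; rewrite inE.
- rewrite (oct_classS rho_inj rho1 rhoM rho_det T24 nKT K4) // inE -HS.
  by apply: eq_bigl => y; rewrite inE.
- rewrite (oct_class1 rho_inj rho1 rhoM rho_det T24) // inE -HF.
  by apply: eq_bigl => y; rewrite inE.
Qed.

Lemma oct_bound u : gr_torsion u ->
  (-3 <= u 1%g * 3 - SA u - SS u + SF u <= 3) /\ (-3 <= u 1%g * 3 - SA u + SS u - SF u <= 3).
Proof.
move=> tu; have [b _] := torsion_trace rho1 rhoM tu.
have [b' _] := torsion_trace oct_rho'1 oct_rho'M tu.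
by move: b b'; rewrite sum_trace sum_trace'; split; lia.
Qed.

(** Multiply by [s0^-1] in both representations and halve the difference of traces: only [x] outside
    [E] remain. There [x * s0^-1] has trace 3 at [s0], -1 on the rest of [K :* s0] and 0
    elsewhere. *)
Lemma oct_scalar_coef u (s0 : gT) (e : int) : s0 \notin E ->
    gr_lin rho u = e%:M -> gr_lin oct_rho' u = (- e)%:M ->
  u s0 * 4 - \sum_(x in (K :* s0)%g) u x = e * t s0.
Proof.
move=> nEs ru ru'.
have tru : \sum_x u x * t (x * s0^-1)%g = e * t s0.
  have : \tr (gr_lin rho u *m rho s0^-1%g) = e * t s0.
    by rewrite ru mul_scalar_mx mxtraceZ -/(rtr rho _) (rtrV rho1 rhoM).
  move=> <-; rewrite /gr_lin mulmx_suml raddf_sum; apply: eq_bigr => x _ /=.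
  by rewrite -scalemxAl mxtraceZ -rhoM.
have tru' : \sum_x u x * (oct_sgn x * t (x * s0^-1)%g) = - (e * t s0).
  have : \tr (gr_lin oct_rho' u *m rho s0^-1%g) = - (e * t s0).
    by rewrite ru' mul_scalar_mx mxtraceZ -/(rtr rho _) (rtrV rho1 rhoM) mulNr.
  move=> <-; rewrite /gr_lin mulmx_suml raddf_sum; apply: eq_bigr => x _ /=.
  by rewrite -scalemxAl mxtraceZ /oct_rho' -scalemxAl mxtraceZ -rhoM.
have key : \sum_(x | x \notin E) u x * t (x * s0^-1)%g = e * t s0.
  have : (\sum_(x | x \notin E) u x * t (x * s0^-1)%g) *+ 2 = (e * t s0) *+ 2.
    rewrite -[RHS]/(_ + _) -{1}tru -[X in _ + X]opprK -tru' -sumrB -sumrMnl big_mkcond.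
    apply: eq_bigr => x _; rewrite /oct_sgn; case: (boolP (x \in E)) => _ /=.
      by rewrite mul1r subrr.
    by rewrite mulN1r mulrN opprK.
  by lia.
rewrite -key [RHS](bigID (fun x => x \in (K :* s0)%g)) /= [X in _ = _ + X]big1 ?addr0 => [|x]; last first.
  case/andP=> nEx; rewrite mem_rcoset => nK.
  have : (x * s0^-1 \in E)%g.
    have := oct_sgnM x s0^-1%g; rewrite /oct_sgn (negPf nEx) groupV (negPf nEs).
    by case: ifP.
  by rewrite EP (negPf nK) => /eqP ->; rewrite mulr0.
have s0K : s0 \in (K :* s0)%g by rewrite mem_rcoset mulgV group1.
have sub x : x \in (K :* s0)%g -> x \notin E.
  rewrite mem_rcoset => xK; apply/negP => Ex; case/negP: nEs.
  have : (x * s0^-1 \in E)%g by rewrite EP xK.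
  by rewrite groupMl // groupV.
rewrite [RHS](eq_bigl (fun x => x \in (K :* s0)%g)) => [|x]; last first.
  by apply/andP/idP => [[]//|xK]; rewrite sub.
rewrite (bigD1 s0) //= [RHS](bigD1 s0) //= mulgV t1.
rewrite [X in _ = _ + X](eq_bigr (fun x => - u x)) ?sumrN => [|x /andP[]]; first by ring.
rewrite mem_rcoset => xK nx; rewrite K_trace ?mulrN1 //.
by rewrite -eq_mulgV1.
Qed.

Lemma oct_class_like_units (s f : gT) : t s = -1 -> t f = 1 -> s \notin K -> (K :* s = K :* f)%g ->
  torsion_class_like gT.
Proof.
move=> ts tf nKs sf u tu au.
have [u1|nu1] := eqVneq (u 1%g) 0; last first.
  by exists 1%g; rewrite (torsion_coef1 tu au nu1); apply: class_like_of.
have [g gP] := oct_quotient tu au.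
have [] := gP 1%N; rewrite gr_pow1 expg1 u1 add0r => gK gE.
have sum1 := sum_classes u; rewrite au u1 add0r in sum1.
have [bd bd'] := oct_bound tu; rewrite u1 in bd bd'.
have [v vE] : exists v, gr_pow u 2 = v by exists (gr_pow u 2).
have tv : gr_torsion v by rewrite -vE; apply: gr_torsion_pow.
have av : augmentation v = 1 by rewrite -vE augmentation_pow au expr1n.
have [] := gP 2%N; rewrite vE => gK2 gE2.
have := oct_sqr_congr u; rewrite vE => /dvdzP[q cong].
have [bd2 bd2'] := oct_bound tv.
have sum2 := sum_classes v; rewrite av in sum2.
have v1 : v 1%g = 0 \/ v = gr_one gT int.
  have [->|nv] := eqVneq (v 1%g) 0; [by left | right].
  exact: torsion_coef1 tv av nv.
have SA1 : SA (gr_one gT int) = 0.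
  by rewrite /SA big1 // => x /andP[_ /negPf nx]; rewrite ffunE nx.
have [b tb] := @oct_exists _ _ rho_inj rho1 rhoM rho_det T24 0 isT.
have [w Kw nw] : exists2 w, w \in K & w != 1%g.
  have := klein_sharp K4; case: (set_0Vmem (K :\ 1)%g) => [-> |[w]]; first by rewrite cards0.
  by rewrite !inE => /andP[nw Kw] _; exists w.
(* With trace -3, [u] acts as -1 and its square as 1. *)
have sq (r : gT -> 'M[int]_3) : r 1%g = 1%:M -> (forall x y, r (x * y)%g = r x *m r y) ->
    \sum_x u x * \tr (r x) = -3 -> \sum_x v x * \tr (r x) = 3.
  move=> r1 rM tr3; have [_ /(_ (-1) (normrN1 _) tr3) ru] := torsion_trace r1 rM tu.
  rewrite -mxtrace_gr_lin -vE gr_lin_pow // ru expr2 -[_ * _]/(_ *m _) -scalar_mxM mulN1r opprK.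
  by rewrite mxtrace1.
rewrite mul0r sub0r in bd bd'.
(* For [g] in [K] the candidate is an involution of [K]; otherwise [SF u] is 1 or -1. *)
case: (boolP (g \in K)) gK => [Kg|nKg] /= gK.
  have Eg : g \in E by rewrite EP Kg.
  rewrite Eg gK /= in gE; rewrite groupX ?Kg //= in gK2; rewrite groupX ?Eg // gK2 /= in gE2.
  have B0 : SB u = 0 by move: gE; clear; lia.
  have S0 : SS u = - SF u by move: sum1; rewrite gK B0; clear; lia.
  have [F0|nF0] := eqVneq (SF u) 0.
    exists w; apply: oct_clikeP; rewrite ?u1 ?gK ?B0 ?S0 ?F0 ?Kw ?K_trace //.
    - by rewrite (negPf nw).
    - by rewrite nw.
  have F1 : SF u = 1 \/ SF u = -1.
    by move: bd bd' nF0; rewrite gK S0; move: (SF u); clear; lia.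
  have v0 : v 1%g = 0.
    by case: v1 => // v1; move: F1 cong; rewrite v1 SA1; move: (SF u); clear; lia.
  rewrite v0 add0r in gK2; rewrite v0 gK2 add0r in gE2 sum2; rewrite v0 gK2 mul0r sub0r in bd2 bd2'.
  have B2 : SB v = 0 by move: gE2; move: (SB v); clear; lia.
  have S2 : SS v = - SF v by move: sum2; rewrite B2; move: (SS v) (SF v); clear; lia.
  (* One of the two traces of [u] is -3, so that trace of [u^2] is 3, and then the other trace of
     [u^2] violates its bound. *)
  rewrite S2 in bd2 bd2'; case: F1 => F1.
    have := sq _ oct_rho'1 oct_rho'M; rewrite !sum_trace' u1 v0 gK gK2 S0 S2 F1.
    by move=> /(_ erefl); move: bd2; move: (SF v); clear; lia.
  have := sq _ rho1 rhoM; rewrite !sum_trace u1 v0 gK gK2 S0 S2 F1.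
  by move=> /(_ erefl); move: bd2'; move: (SF v); clear; lia.
(* For [g] in [E] outside [K], the bound leaves [SF u] in -1, 0, 1 and the congruence makes it
   even. *)
case: (boolP (g \in E)) gE => [Eg|nEg] /= gE; rewrite gK add0r in gE; rewrite gK gE in sum1.
  have tg : t g = 0 by move: Eg; rewrite EP (negPf nKg) => /eqP.
  have tg2 : t (g ^+ 2)%g = 0 by rewrite t_sqr tg.
  have nKg2 : (g ^+ 2 \notin K)%g by apply/negP => /K_not3.
  rewrite (negPf nKg2) /= in gK2.
  have v0 : v 1%g = 0.
    by case: v1 => // v1; move: gK2; rewrite v1 SA1 ffunE eqxx.
  have A2 : SA v = 0 by rewrite v0 add0r in gK2.
  have S0 : SS u = - SF u by move: sum1; move: (SS u) (SF u); clear; lia.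
  have F0 : SF u = 0.
    by move: bd cong; rewrite gK A2 S0; move: (SF u); clear; lia.
  exists b; have nKb : b \notin K by apply/negP => /K_not3.
  have nb : b != 1%g by apply: contraNneq nKb => ->.
  by apply: oct_clikeP; rewrite ?u1 ?gK ?gE ?S0 ?F0 ?(negPf nb) ?(negPf nKb) ?tb.
(* For [g] outside [E] only [SS u] and [SF u] can be nonzero; their sum is 1 and their difference at
   most 3 in absolute value. *)
have nEs : s \notin E by rewrite EP (negPf nKs) ts.
have nEf : f \notin E by case: (octP f) => // [e|_ _ e|_ e]; move: tf; rewrite e ?t1.
have nKf : f \notin K by apply: contraNN nEf => Kf; rewrite EP Kf.
have ns : s != 1%g by apply: contraNneq nKs => ->.
have nf : f != 1%g by apply: contraNneq nKf => ->.
have F1 : SF u = 1 - SS u by move: sum1; move: (SS u) (SF u); clear; lia.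
have [S0|nS0] := eqVneq (SS u) 0.
  by exists f; apply: oct_clikeP; rewrite ?u1 ?gK ?gE ?F1 ?S0 ?(negPf nf) ?(negPf nKf) ?tf.
have [S1|nS1] := eqVneq (SS u) 1.
  by exists s; apply: oct_clikeP; rewrite ?u1 ?gK ?gE ?F1 ?S1 ?(negPf ns) ?(negPf nKs) ?ts.
(* The spurious case: both traces reach the bound with opposite signs. *)
have [e e1 [S3 S3']] : exists2 e : int, `|e| = 1 &
    SF u - SS u = e *+ 3 /\ SS u - SF u = (- e) *+ 3.
  have [Se|Se] : SS u = -1 \/ SS u = 2.
  - by move: bd nS0 nS1; rewrite gK F1; move: (SS u); clear; lia.
  - by exists 1 => //; rewrite F1 Se.
  - by exists (-1) => //; rewrite F1 Se.
have [_ /(_ e e1) H] := torsion_trace rho1 rhoM tu.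
have [_ /(_ (- e)) H'] := torsion_trace oct_rho'1 oct_rho'M tu.
have ru : gr_lin rho u = e%:M.
  by apply: H; rewrite sum_trace u1 gK -S3 mul0r subr0 sub0r addrC.
have ru' : gr_lin oct_rho' u = (- e)%:M.
  by apply: H'; rewrite ?normrN // sum_trace' u1 gK -S3' mul0r subr0 add0r.
(* The coset sums agree, so the difference reads [4 * (u f - u s) = 2 * e], impossible for a sign
   [e]. *)
have := oct_scalar_coef nEs ru ru'; have := oct_scalar_coef nEf ru ru'.
rewrite sf ts tf; move: e1; move: (u s) (u f) (\sum_(x in _) u x); clear; lia.
Qed.
End OctahedralUnits.

(** * From SL_3(Z) to GL_3(Z) *)

Theorem rotation_class_like (gT : finGroupType) (rho : gT -> 'M[int]_3) :
    injective rho -> rho 1%g = 1%:M -> (forall x y, rho (x * y)%g = rho x *m rho y) ->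
    (forall x, \det (rho x) = 1) ->
  torsion_class_like gT.
Proof.
move=> rho_inj rho1 rhoM rho_det; case: (eqVneq #|[set: gT]| 24%N) => [T24|nT24]; last first.
  by apply: coset_conj_class_like; apply: (rot_small_coset_conj rho_inj rho1 rhoM rho_det).
have [K [nKT K4 [P P8 sKP]]] := oct_klein rho_inj rho1 rhoM rho_det T24.
have [E [nET iE EP]] := oct_even rho_inj rho1 rhoM rho_det T24 nKT K4.
have [s [f [ts tf nKs sf]]] := oct_coset rho_inj rho1 rhoM rho_det T24 nKT K4 P8 sKP.
exact: (oct_class_like_units rho_inj rho1 rhoM rho_det T24 nKT K4 nET iE EP ts tf nKs sf).
Qed.

(** Multiplying each matrix by its determinant loses at most the element [c] that acts as -1.
    Without such an element the result is faithful; otherwise it is faithful modulo [c], and the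
    determinant is the sign of the double cover. *)
Theorem crystallographic_class_like (gT : finGroupType) :
  crystallographic3 gT -> torsion_class_like gT.
Proof.
case=> r [r_inj r1 rM]; pose lam x := \det (r x).
have lamM x y : lam (x * y)%g = lam x * lam y by rewrite /lam rM det_mulmx.
have lam_sign x : lam x = 1 \/ lam x = -1.
  have : lam x * lam x^-1%g = 1 by rewrite -lamM mulgV /lam r1 det1.
  move/(congr1 absz)/eqP; rewrite abszM /= muln_eq1 => /andP[/eqP + _].
  by move: (lam x); clear; lia.
have lam2 x : lam x * lam x = 1 by case: (lam_sign x) => ->.
pose rho x := lam x *: r x.
have rho1 : rho 1%g = 1%:M by rewrite /rho /lam r1 det1 scale1r.
have rhoM x y : rho (x * y)%g = rho x *m rho y.
  by rewrite /rho lamM rM -scalemxAl -scalemxAr scalerA.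
(* In dimension 3 this determinant is [lam x ^+ 4]. *)
have rho_det x : \det (rho x) = 1.
  by rewrite /rho detZ -/(lam x) -exprSr; case: (lam_sign x) => ->.
have rK x : r x = lam x *: rho x by rewrite /rho scalerA lam2 scale1r.
have rho_eq1 x : rho x = 1%:M -> r x = 1%:M \/ r x = (-1)%:M.
  by move=> x1; rewrite rK x1; case: (lam_sign x) => ->; rewrite scale_scalar_mx mulr1; [left|right].
have rho_eq x y : rho x = rho y -> rho (x^-1 * y)%g = 1%:M.
  by move=> xy; rewrite rhoM -xy -rhoM mulVg rho1.
have r_eq1 x : r x = 1%:M -> x = 1%g by rewrite -r1 => /r_inj.
case: (pickP (fun c => r c == (-1)%:M)) => [c /eqP rc|noc]; last first.
  apply: (rotation_class_like (rho := rho)) => // x y /rho_eq/rho_eq1[/r_eq1 e|e].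
    by apply: (mulgI x^-1%g); rewrite e mulVg.
  by have := noc (x^-1 * y)%g; rewrite e eqxx.
have lamc : lam c = -1 by rewrite /lam rc det_scalar.
have rhoc : rho c = 1%:M by rewrite /rho lamc rc scale_scalar_mx mulrNN mulr1.
have cc : (c ^+ 2 = 1)%g.
  by apply: r_eq1; rewrite expgS expg1 rM rc -scalar_mxM mulrNN mulr1.
have nc : c != 1%g by apply: contra_eq_neq lamc => ->; rewrite /lam r1 det1.
have cE : <[c]>%g = [set 1%g; c] by apply: cycle2g; apply: nt_prime_order.
pose C := <[c]>%G; have nC : [set: gT] \subset 'N(C).
  apply: subset_trans (cent_sub _); rewrite centsC cycle_subG; apply/centP => x _.
  by apply: r_inj; rewrite !rM rc scalar_mxC.
have Crho x : x \in C -> rho x = 1%:M.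
  by rewrite /= cE !inE => /orP[] /eqP ->.
(* Independent of the representative, since [rho] is 1 on [C]. *)
pose rhoC (y : coset_of C) := rho (repr y).
have rhoCE x : rhoC (coset C x) = rho x.
  have /eqP := coset_reprK (coset C x); rewrite eq_sym quo_eq // => /Crho e.
  by rewrite -[RHS]mulmx1 -e -rhoM mulKVg.
have coset_surj y : exists x, coset C x = y by exists (repr y); rewrite coset_reprK.
have fM := quo_mul nC.
apply: (@class_like_double _ _ (coset C) lam c) => //.
- by apply: coset_id; rewrite cycle_id.
- move=> x x1; have : x \in C by apply: coset_idr; rewrite // (subsetP nC) ?inE.
  by rewrite /= cE !inE => /orP[] /eqP; [left|right].
apply: (rotation_class_like (rho := rhoC)).
- move=> y1 y2; have [[x <-] [z <-]] := (coset_surj y1, coset_surj y2).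
  rewrite !rhoCE => /rho_eq/rho_eq1 e; apply/eqP; rewrite quo_eq //= cE !inE.
  by case: e => [/r_eq1 ->|e]; rewrite ?eqxx //; apply/orP; right; apply/eqP/r_inj; rewrite e rc.
- by rewrite -rho1 -rhoCE morph1.
- move=> y1 y2; have [[x <-] [z <-]] := (coset_surj y1, coset_surj y2).
  by rewrite -fM !rhoCE rhoM.
- by move=> y; have [x <-] := coset_surj y; rewrite rhoCE.
Qed.

Theorem mainTheorem3 (gT : finGroupType) :
  crystallographic3 gT ->
  forall u : {ffun gT -> int}, torsion_unit_V u ->
  exists g : gT, QG_conjugate (gr_ZtoQ u) (gr_of rat g).
Proof.
move=> crys u [_ [au tu]].
exact: class_like_conjugate (crystallographic_class_like crys) tu au.
Qed.
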